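(* Let $\mathbf t(\mathbf y)=\mathbf t_0$, a constant, and let $\boldsymbol\xi_0=(\mathbf W'\mathbf Q^{-1/2}\mathbf H_2')^{-1}\mathbf t_0$. Assume a prior distribution $\pi(\boldsymbol\xi_4)$ for $\boldsymbol\xi_4$ and the point mass prior $P^{\pi}[\boldsymbol\xi_2=\boldsymbol\xi_0]=1$ for $\boldsymbol\xi_2$. Then the resulting generalized Bayes estimator of $\boldsymbol\mu$, $$\widehat{\boldsymbol\mu}^{\mathrm{GB2}}=\mathbf Q^{-1/2}\mathbf H_1'\widehat{\boldsymbol\xi}_4^{\mathrm{GB}}(\mathbf z_4,\mathbf V_{11.2})+\mathbf Q^{-1/2}\mathbf H_2'\boldsymbol\xi_0,$$ satisfies the constraint, namely $\widehat{\boldsymbol\mu}^{\mathrm{GB2}}\in\Gamma_C$. Moreover: (1) If the estimator $\widehat{\boldsymbol\xi}_4^{\mathrm{GB}}$ of $\boldsymbol\xi_4$ is admissible in terms of the risk $R^*(\boldsymbol\xi_4,\cdot)$, then $\widehat{\boldsymbol\mu}^{\mathrm{GB2}}$ is admissible in $\Gamma$ (and also in $\Gamma_C$). (2) If $R^*(\boldsymbol\xi_4,\widehat{\boldsymbol\xi}_4^{\mathrm{GB}})\le R^*(\boldsymbol\xi_4,\mathbf z_4)$ for all $\boldsymbol\xi_4$, then $\widehat{\boldsymbol\mu}^{\mathrm{GB2}}$ is minimax within the class $\Gamma_C$. Further, it is minimax in $\Gamma$ when $\boldsymbol\mu$ is restricted to $\mathbf W'\boldsymbol\mu=\mathbf t_0$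 (equivalently $\boldsymbol\xi_2=\boldsymbol\xi_0$).
   Context: Model: $\mathbf y\,|\,\boldsymbol\mu\sim\mathcal N_k(\boldsymbol\mu,\mathbf D)$ with $\boldsymbol\mu\in\mathbb R^k$ unknown and $\mathbf D=\mathrm{diag}(d_1,\dots,d_k)$ known, $d_i>0$. $\mathbf Q$ is a fixed $k\times k$ (symmetric) positive definite matrix with symmetric square root $\mathbf Q^{1/2}$; $\mathbf W$ is a fixed $k\times m$ matrix of rank $m$, $m<k$; the benchmark constraint is $\mathbf W'\widehat{\boldsymbol\mu}=\mathbf t(\mathbf y)$. $\Gamma$ is the class of estimators $\widehat{\boldsymbol\mu}=\widehat{\boldsymbol\mu}(\mathbf y)$ with $E[\widehat{\boldsymbol\mu}'\widehat{\boldsymbol\mu}\,|\,\boldsymbol\mu]<\infty$; the risk is $R(\boldsymbol\mu,\widehat{\boldsymbol\mu})=E[(\widehat{\boldsymbol\mu}-\boldsymbol\mu)'\mathbf Q(\widehat{\boldsymbol\mu}-\boldsymbol\mu)\,|\,\boldsymbol\mu]$. For $\widehat{\boldsymbol\mu}\in\Gamma$, $$\widehat{\boldsymbol\mu}^{C}(\widehat{\boldsymbol\mu},\mathbf t)=\widehat{\boldsymbol\mu}+\mathbf Q^{-1}\mathbf W(\mathbf W'\mathbf Q^{-1}\mathbf W)^{-1}\{\mathbf t(\mathbf y)-\mathbf W'\widehat{\boldsymbol\mu}\},$$ and $\Gamma_C=\{\widehat{\boldsymbol\mu}^{C}(\widehat{\boldsymbol\mu},\mathbf t)\,|\,\widehat{\boldsymbol\mu}\in\Gamma\}$.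 $\mathbf H$ is a $k\times k$ orthogonal matrix such that $$\mathbf H\mathbf Q^{-1/2}\mathbf W(\mathbf W'\mathbf Q^{-1}\mathbf W)^{-1}\mathbf W'\mathbf Q^{-1/2}\mathbf H'=\begin{pmatrix}\mathbf 0_{k-m}&\mathbf 0\\ \mathbf 0&\mathbf I_m\end{pmatrix},$$ with $\mathbf H_1$ its first $k-m$ rows and $\mathbf H_2$ its last $m$ rows; $\mathbf W'\mathbf Q^{-1/2}\mathbf H_2'$ is assumed nonsingular. Put $\mathbf z_i=\mathbf H_i\mathbf Q^{1/2}\mathbf y$, $\boldsymbol\xi_i=\mathbf H_i\mathbf Q^{1/2}\boldsymbol\mu$, $\mathbf V_{ij}=\mathbf H_i\mathbf Q^{1/2}\mathbf D\mathbf Q^{1/2}\mathbf H_j'$ for $i,j=1,2$, and $$\mathbf z_4=\mathbf z_1-\mathbf V_{12}\mathbf V_{22}^{-1}(\mathbf z_2-\boldsymbol\xi_0),\quad \boldsymbol\xi_4=\boldsymbol\xi_1-\mathbf V_{12}\mathbf V_{22}^{-1}(\boldsymbol\xi_2-\boldsymbol\xi_0),\quad \mathbf V_{11.2}=\mathbf V_{11}-\mathbf V_{12}\mathbf V_{22}^{-1}\mathbf V_{21}.$$ Then $\mathbf z_4\sim\mathcal N_{k-m}(\boldsymbol\xi_4,\mathbf V_{11.2})$ and $\mathbf z_2\sim\mathcal N_m(\boldsymbol\xi_2,\mathbf V_{22})$ are independent. $\widehat{\boldsymbol\xi}_4^{\mathrm{GB}}=\widehat{\boldsymbol\xi}_4^{\mathrm{GB}}(\mathbf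 z_4,\mathbf V_{11.2})$ is the generalized Bayes estimator (posterior mean) of $\boldsymbol\xi_4$ in the model $\mathbf z_4\,|\,\boldsymbol\xi_4\sim\mathcal N_{k-m}(\boldsymbol\xi_4,\mathbf V_{11.2})$, $\boldsymbol\xi_4\sim\pi(\boldsymbol\xi_4)$ (possibly improper), assumed to exist with finite second moments. $R^*(\boldsymbol\xi_4,\widehat{\boldsymbol\xi}_4)=E[\|\widehat{\boldsymbol\xi}_4-\boldsymbol\xi_4\|^2\,|\,\boldsymbol\xi_4]$. An estimator is admissible within a class if no estimator of the class has risk no larger for all parameter values and strictly smaller for some; for $\boldsymbol\xi_4$ the problem is estimation from $\mathbf z_4$. An estimator is minimax in a class if its supremum risk equals the infimum over the class of the supremum risks. *)

(* Defs.v *)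
From HB Require Import structures.
From mathcomp Require Import all_boot all_order all_algebra.
From mathcomp Require Import all_classical all_reals all_analysis.
From mathcomp Require Import measurable_realfun.

Set Implicit Arguments.
Unset Strict Implicit.
Unset Printing Implicit Defensive.

Import Order.TTheory GRing.Theory Num.Theory.
Import numFieldNormedType.Exports.

Local Open Scope classical_set_scope.
Local Open Scope ring_scope.

(* The sigma-algebra on column vectors is the one generated by the coordinate
   maps, i.e. the Borel sigma-algebra of R^n. *)
Section measurable_cV.
Context {R : realType} (n : nat).

Let coors : 'I_n -> 'cV[R]_n -> R := fun i v => v i 0.

Let cV_set0 : g_sigma_preimage coors set0.
Proof. exact: sigma_algebra0. Qed.

Let cV_setC A : g_sigma_preimage coors A -> g_sigma_preimage coors (~` A).
Proof. exact: sigma_algebraC. Qed.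

Let cV_bigcup (F : _^nat) : (forall i, g_sigma_preimage coors (F i)) ->
  g_sigma_preimage coors (\bigcup_i (F i)).
Proof. exact: sigma_algebra_bigcup. Qed.

HB.instance Definition _ := @isMeasurable.Build default_measure_display
  'cV[R]_n (g_sigma_preimage coors) cV_set0 cV_setC cV_bigcup.

Lemma measurable_coor (i : 'I_n) :
  measurable_fun [set: 'cV[R]_n] (fun v => v i 0).
Proof.
move=> _ Y mY; rewrite setTI; apply: sub_sigma_algebra => /=.
rewrite -bigcup_seq/=; exists i => /=; first by rewrite mem_index_enum.
by exists Y => //; rewrite setTI.
Qed.

Lemma measurable_fun_cVP d (T : measurableType d) (f : T -> 'cV[R]_n) :
  measurable_fun [set: T] f <->
  forall i, measurable_fun [set: T] (fun x => f x i 0).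
Proof.
split=> [mf i|mf].
  exact: (measurableT_comp (measurable_coor i) mf).
move=> _ Y; rewrite setTI /= => mY.
pose S : set (set 'cV[R]_n) := [set A | measurable (f @^-1` A)].
suff : g_sigma_preimage coors `<=` S by apply; exact: mY.
apply: smallest_sub.
  split=> [|A|F].
  - by rewrite /S /= preimage_set0.
  - by rewrite /S /= setTD preimage_setC; exact: measurableC.
  - by move=> mF; rewrite /S /= preimage_bigcup; exact: bigcupT_measurable.
move=> A; rewrite -bigcup_seq => -[i _ [B mB <-]].
rewrite /S /= setTI; have := mf i measurableT B mB.
by rewrite setTI.
Qed.

End measurable_cV.

Lemma product_measure1_sigma_finite d1 d2 (T1 : measurableType d1)
    (T2 : measurableType d2) (R : realType)
    (m1 : {sigma_finite_measure set T1 -> \bar R})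
    (m2 : {sigma_finite_measure set T2 -> \bar R}) :
  sigma_finite setT (m1 \x m2)%E.
Proof.
have /sigma_finiteP[F [TF ndF Foo]] := sigma_finiteT m1.
have /sigma_finiteP[G [TG ndG Goo]] := sigma_finiteT m2.
exists (fun n => F n `*` G n).
  rewrite -setXTT TF TG predeqE => -[x y]; split.
    move=> [/= [n _ Fnx] [k _ Gky]]; exists (maxn n k) => //; split.
    - by move: x Fnx; exact/subsetPset/ndF/leq_maxl.
    - by move: y Gky; exact/subsetPset/ndG/leq_maxr.
  by move=> [n _ []/= ? ?]; split; exists n.
move=> k; have [? ?] := Foo k; have [? ?] := Goo k.
split; first exact: measurableX.
by rewrite product_measure1E// lte_mul_pinfty// ge0_fin_numE.
Qed.

Section lebesgue_cV.
Context {R : realType}.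

Definition cV_cons n (p : measurableTypeR R * 'cV[R]_n) : 'cV[R]_n.+1 :=
  col_mx (p.1%:M : 'M[R]_1) p.2.

Lemma cV_consE0 n (p : measurableTypeR R * 'cV[R]_n) :
  cV_cons p ord0 0 = p.1.
Proof.
have -> : ord0 = lshift n (0 : 'I_1) by exact: val_inj.
by rewrite /cV_cons [LHS]col_mxEu mxE mulr1n.
Qed.

Lemma cV_consES n (p : measurableTypeR R * 'cV[R]_n) j :
  cV_cons p (lift ord0 j) 0 = p.2 j 0.
Proof.
have -> : lift ord0 j = rshift 1 j by exact: val_inj.
by rewrite /cV_cons [LHS]col_mxEd.
Qed.

Lemma measurable_cV_cons n : measurable_fun setT (@cV_cons n).
Proof.
apply/measurable_fun_cVP => i; case: (unliftP ord0 i) => [j|] ->.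
  under eq_fun do rewrite cV_consES.
  by apply: (measurableT_comp (measurable_coor j)).
under eq_fun do rewrite cV_consE0.
exact: measurable_fst.
Qed.

Lemma cV_cons_preimage_sigma_finite n
    (leb : {sigma_finite_measure set 'cV[R]_n -> \bar R}) :
  sigma_finite setT
    (pushforward (@lebesgue_measure R \x leb)%E (@cV_cons n)).
Proof.
have [F TF Foo] := product_measure1_sigma_finite (@lebesgue_measure R) leb.
pose tl (v : 'cV[R]_n.+1) : measurableTypeR R * 'cV[R]_n :=
  (v ord0 0, \col_i v (lift ord0 i) 0).
have consK : cancel (@cV_cons n) tl.
  move=> [x v]; rewrite /tl cV_consE0; congr pair.
  by apply/colP => i; rewrite mxE cV_consES.
have mtl : measurable_fun setT tl.
  apply/measurable_fun_pairP; split.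
    exact: (measurable_coor ord0).
  apply/measurable_fun_cVP => i.
  rewrite (_ : (fun _ => _) = (fun v : 'cV[R]_n.+1 => v (lift ord0 i) 0)).
    exact: measurable_coor.
  by apply/funext => v /=; rewrite mxE.
exists (fun k => tl @^-1` F k).
  by rewrite -preimage_bigcup -TF preimage_setT.
move=> k; have [mF Fk] := Foo k; split.
  by rewrite -[X in measurable X]setTI; exact: mtl.
rewrite /pushforward (_ : _ @^-1` _ = F k)//.
by apply/seteqP; split=> x; rewrite /= consK.
Qed.


Definition lebesgue_cV_step n
    (leb : {sigma_finite_measure set 'cV[R]_n -> \bar R}) : set 'cV[R]_n.+1 -> \bar R :=
  pushforward (@lebesgue_measure R \x leb)%E (@cV_cons n).

HB.instance Definition _ n (leb : {sigma_finite_measure set 'cV[R]_n -> \bar R}) :=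
  Measure.copy (lebesgue_cV_step leb)
    (measure_function_pushforward__canonical__measure_function_Measure
       (@lebesgue_measure R \x leb)%E (@measurable_cV_cons n)).

HB.instance Definition _ n (leb : {sigma_finite_measure set 'cV[R]_n -> \bar R}) :=
  @Measure_isSigmaFinite.Build _ _ _ (lebesgue_cV_step leb)
    (cV_cons_preimage_sigma_finite leb).

(* n-dimensional Lebesgue measure as an iterated product; on 'cV_0, which has
   a single element, it is the unit mass. *)
Fixpoint lebesgue_cV n : {sigma_finite_measure set 'cV[R]_n -> \bar R} :=
  match n with
  | 0 => \d_(0 : 'cV[R]_0)
  | n'.+1 => lebesgue_cV_step (lebesgue_cV n')
  end.

End lebesgue_cV.

Definition qform {R : realType} n (Q : 'M[R]_n) (v : 'cV[R]_n) : R :=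
  (v^T *m Q *m v) 0 0.

(* Squared Euclidean norm; the library's norm on matrices is the sup norm. *)
Definition sqnorm {R : realType} n (v : 'cV[R]_n) : R := (v^T *m v) 0 0.

Definition posdefmx {R : realType} n (Q : 'M[R]_n) : Prop :=
  Q^T = Q /\ forall v : 'cV[R]_n, v != 0 -> 0 < qform Q v.

Section multinormal.
Context {R : realType} (n : nat).
Implicit Types (mu x : 'cV[R]_n) (Sigma : 'M[R]_n).

(* Intended for positive definite Sigma only. *)
Definition multinormal_pdf mu Sigma x : R :=
  (Num.sqrt ((2 * pi) ^+ n * \det Sigma))^-1 *
  expR (- qform (invmx Sigma) (x - mu) / 2).

Lemma multinormal_pdf_ge0 mu Sigma x : 0 <= multinormal_pdf mu Sigma x.
Proof. by rewrite mulr_ge0 ?expR_ge0// invr_ge0. Qed.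

Lemma measurable_qform d (T : measurableType d) (Q : 'M[R]_n) (f : T -> 'cV[R]_n) :
  measurable_fun setT f -> measurable_fun setT (fun t => qform Q (f t)).
Proof.
move=> /measurable_fun_cVP mf; rewrite /qform.
under eq_fun do rewrite mxE.
apply: measurable_sum => j; apply: measurable_funM; last exact: mf.
under eq_fun do rewrite mxE.
apply: measurable_sum => l; apply: measurable_funM => //.
by under eq_fun do rewrite mxE; exact: mf.
Qed.

Lemma measurable_multinormal_pdf mu Sigma :
  measurable_fun setT (multinormal_pdf mu Sigma).
Proof.
apply: measurable_funM => //; apply: measurableT_comp => //.
apply: measurable_funM => //; apply: measurableT_comp => //.
apply: measurable_qform; apply/measurable_fun_cVP => i.
under eq_fun do rewrite mxE.
by apply: measurable_funD => //; exact: measurable_coor.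
Qed.

(* The distribution N_n(mu, Sigma). *)
Definition multinormal mu Sigma (A : set 'cV[R]_n) : \bar R :=
  (\int[lebesgue_cV n]_(x in A) (multinormal_pdf mu Sigma x)%:E)%E.

Let multinormal0 mu Sigma : multinormal mu Sigma set0 = 0%E.
Proof. by rewrite /multinormal integral_set0. Qed.

Let multinormal_ge0 mu Sigma A : (0 <= multinormal mu Sigma A)%E.
Proof. by apply: integral_ge0 => x _; rewrite lee_fin multinormal_pdf_ge0. Qed.

Let multinormal_sigma_additive mu Sigma :
  semi_sigma_additive (multinormal mu Sigma).
Proof.
move=> F mF tF mUF; rewrite /multinormal ge0_integral_bigcup//=.
- apply: is_cvg_ereal_nneg_natsum_cond => k _ _.
  by apply: integral_ge0 => x _; rewrite lee_fin multinormal_pdf_ge0.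
- apply/measurable_EFinP; apply: measurable_funTS.
  exact: measurable_multinormal_pdf.
- by move=> x _; rewrite lee_fin multinormal_pdf_ge0.
Qed.

HB.instance Definition _ mu Sigma := isMeasure.Build _ _ _
  (multinormal mu Sigma) (multinormal0 mu Sigma) (multinormal_ge0 mu Sigma)
  (@multinormal_sigma_additive mu Sigma).

End multinormal.

Section estimation.
Context {R : realType}.

(* Estimators of a normal mean with finite second moments. *)
Definition Gamma n (Sigma : 'M[R]_n) : set ('cV[R]_n -> 'cV[R]_n) :=
  [set delta | measurable_fun setT delta /\
    forall mu, (\int[multinormal mu Sigma]_y (sqnorm (delta y))%:E < +oo)%E].

Definition risk n (Q Sigma : 'M[R]_n) (mu : 'cV[R]_n)
    (delta : 'cV[R]_n -> 'cV[R]_n) : \bar R :=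
  (\int[multinormal mu Sigma]_y (qform Q (delta y - mu))%:E)%E.

Definition risk_star n (V : 'M[R]_n) (xi : 'cV[R]_n)
    (delta : 'cV[R]_n -> 'cV[R]_n) : \bar R :=
  (\int[multinormal xi V]_z (sqnorm (delta z - xi))%:E)%E.

Definition constrained k m (Q : 'M[R]_k) (W : 'M[R]_(k, m))
    (t : 'cV[R]_k -> 'cV[R]_m) (delta : 'cV[R]_k -> 'cV[R]_k) :
    'cV[R]_k -> 'cV[R]_k :=
  fun y => delta y + invmx Q *m W *m invmx (W^T *m invmx Q *m W)
                     *m (t y - W^T *m delta y).

Definition Gamma_C k m (Q Sigma : 'M[R]_k) (W : 'M[R]_(k, m))
    (t : 'cV[R]_k -> 'cV[R]_m) : set ('cV[R]_k -> 'cV[R]_k) :=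
  [set constrained Q W t delta | delta in Gamma Sigma].

Definition admissible (P E : Type) (C : set E) (r : P -> E -> \bar R) (e : E) :=
  C e /\ ~ exists e', [/\ C e', forall th, (r th e' <= r th e)%E
                        & exists th, (r th e' < r th e)%E].

Definition sup_risk (P E : Type) (Theta : set P) (r : P -> E -> \bar R) (e : E) :=
  ereal_sup [set r th e | th in Theta].

Definition minimax (P E : Type) (Theta : set P) (C : set E)
    (r : P -> E -> \bar R) (e : E) :=
  C e /\ sup_risk Theta r e = ereal_inf [set sup_risk Theta r e' | e' in C].

(* delta is the posterior mean of theta, for the (possibly improper) prior on
   T and the observation x | t ~ N_n(theta t, Sigma).  The existence of the
   posterior and of its mean at every x is part of the definition. *)
Definition generalized_Bayes d (T : measurableType d)
    (prior : {measure set T -> \bar R}) n (theta : T -> 'cV[R]_n)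
    (Sigma : 'M[R]_n) (delta : 'cV[R]_n -> 'cV[R]_n) : Prop :=
  forall x, let lik t := multinormal_pdf (theta t) Sigma x in
  [/\ (0 < \int[prior]_t (lik t)%:E < +oo)%E,
      forall i, prior.-integrable setT (fun t => (theta t i 0 * lik t)%:E)
    & forall i, delta x i 0 =
        (\int[prior]_t (theta t i 0 * lik t)) / (\int[prior]_t lik t)].

End estimation.

(* Main.v *)
From HB Require Import structures.
Require Import Defs.
From mathcomp Require Import all_boot all_order all_algebra.
From mathcomp Require Import all_classical all_reals all_analysis.
From mathcomp Require Import measurable_realfun.
From mathcomp Require Import ring lra.

Import Order.TTheory GRing.Theory Num.Theory.
Import numFieldNormedType.Exports.

Local Open Scope classical_set_scope.
Local Open Scope ring_scope.

(** Put A = H S, so that Q = A^T A and the risk is the squared Euclidean risk of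
    the rotated vector A mu = (xi1, xi2).  Since H carries the column space of
    S^-1 W onto the last m coordinates, the constraint W^T mu = t0 says exactly
    that the second block of A mu equals xi0 ([proposition3p4], through the
    vanishing of the upper block of H S^-1 W).

    The affine change of coordinates y |-> (z4, z2) makes the covariance block
    diagonal, so that z4 ~ N(xi4, V112) and z2 ~ N(xi2, V22) are independent
    ([ge0_integral_of_z]).  This is the Gaussian density transported by the linear
    change of variables formula for Lebesgue measure
    ([ge0_integral_linear_change]) and block elimination ([posdefmx_elim]).  As
    the likelihood factorizes and the prior sits on xi2 = xi0, the factor
    depending on z2 cancels in the posterior mean, which is therefore the image
    of the posterior mean of xi4 ([generalized_Bayes_prod_dirac]).

    On the constrained set, xi2 = xi0, the law of z2 is known.  Averaging the
    first rotated block of an arbitrary estimator over z2 then gives an estimator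
    of xi4 based on z4, with no larger risk by Jensen ([risk_blackwell_le]),
    while the benchmarked estimator has risk exactly R*(xi4, xi4GB)
    ([risk_benchmarked]).  Any competitor over Gamma is so compared with xi4GB.

    Admissibility: suppose that e has risk no larger than the benchmarked
    estimator for every mu.  By the parallelogram identity their midpoint is at
    least as good on the constrained set, and strictly better unless both agree
    almost everywhere; its average over z2 would contradict the admissibility of
    xi4GB.  So e agrees almost everywhere with the benchmarked estimator, and
    has the same risk for all mu ([admissible_benchmarked]).

    Minimaxity: no estimator of xi4 has supremum risk below the constant risk
    r0 of z4 ([mean_sqnorm_le_sup_risk]).  Indeed for the prior N(0, tau V) with
    tau = c / (1 - c) the posterior is N(c z, c V); it is symmetric about its
    mean, so that by the parallelogram law the posterior risk of any estimate is
    at least c r0, and c tends to 1.  This settles the restricted problem.  In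
    Gamma_C without restriction on mu every estimator has xi2 estimated by xi0,
    hence infinite supremum risk as soon as m > 0 ([sup_risk_infty]); for m = 0
    the constraint is empty and the restricted problem is the whole problem. *)

Set Implicit Arguments.
Unset Strict Implicit.
Unset Printing Implicit Defensive.

(** * Integration: densities and products with a point mass *)

Section density.
Local Open Scope ereal_scope.
Context d (T : measurableType d) (R : realType).
Import HBNNSimple.

(** Monotone convergence along simple functions, for which the formula is
    linearity applied to the hypothesis on sets. *)
Lemma ge0_integral_density (mu nu : {measure set T -> \bar R}) (g : T -> R)
    (mg : measurable_fun [set: T] g) (g0 : forall x, (0 <= g x)%R)
    (nuE : forall A, measurable A -> nu A = \int[mu]_(x in A) (g x)%:E)
    (f : T -> \bar R) (mf : measurable_fun [set: T] f)
    (f0 : forall x, 0 <= f x) :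
  \int[nu]_x f x = \int[mu]_x (f x * (g x)%:E).
Proof.
have mg' : measurable_fun [set: T] (EFin \o g) by exact/measurable_EFinP.
pose h := nnsfun_approx measurableT mf.
have -> : \int[nu]_x f x =
    lim (\int[nu]_x (EFin \o h n) x @[n --> \oo]).
  rewrite -monotone_convergence//.
  - apply: eq_integral => x _; apply/esym/cvg_lim => //.
    exact: cvg_nnsfun_approx.
  - by move=> n; exact/measurable_EFinP.
  - by move=> n x _ /=; rewrite lee_fin.
  - by move=> x _ a b ab; rewrite lee_fin; exact/lefP/nd_nnsfun_approx.
have -> : \int[mu]_x (f x * (g x)%:E) =
    lim (\int[mu]_x ((EFin \o h n) x * (g x)%:E) @[n --> \oo]).
  rewrite -monotone_convergence//.
  - apply: eq_integral => x _; apply/esym/cvg_lim => //.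
    by apply: cvgeZr => //; exact: cvg_nnsfun_approx.
  - by move=> n; apply: emeasurable_funM => //; exact/measurable_EFinP.
  - by move=> n x _ /=; rewrite mule_ge0 ?lee_fin.
  - move=> x _ a b ab /=.
    by rewrite lee_wpmul2r ?lee_fin//; exact/lefP/nd_nnsfun_approx.
suff suf n : \int[nu]_x (EFin \o h n) x =
    \int[mu]_x ((EFin \o h n) x * (g x)%:E).
  by under eq_fun do rewrite suf.
transitivity (\int[nu]_x
   (\sum_(y \in range (h n)) (y * \1_(h n @^-1` [set y]) x)%:E)).
  by apply: eq_integral => t _; rewrite /= fimfunE -fsumEFin.
have indich r : measurable_fun [set: T] (fun x => (r * \1_(h n @^-1` [set r]) x)%:E).
  by apply: (measurable_comp measurableT) => //; exact: measurable_funM.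
rewrite ge0_integral_fsum//; last by move=> m y _; exact: nnfun_muleindic_ge0.
transitivity (\int[mu]_x (\sum_(y \in range (h n))
    (y * \1_(h n @^-1` [set y]) x)%:E * (g x)%:E)); last first.
  apply: eq_integral => x _; rewrite /= -ge0_mule_fsuml => [|y]; last first.
    exact: nnfun_muleindic_ge0.
  by rewrite fsumEFin // -(fimfunE _ x).
rewrite ge0_integral_fsum//; last 2 first.
  - by move=> y; exact: emeasurable_funM.
  - by move=> m y _; apply: mule_ge0; [exact: nnfun_muleindic_ge0|rewrite lee_fin].
apply: eq_fsbigr => r rhn.
have r0 : (0 <= r)%R by move: rhn; rewrite inE => -[x _ <-]; exact: fun_ge0.
under eq_integral do rewrite EFinM.
rewrite integralZl_indic_nnsfun => //.
under [RHS]eq_integral do rewrite EFinM -muleA.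
rewrite ge0_integralZl//.
- congr (_ * _); rewrite integral_indic// setIT nuE//.
  rewrite integral_mkcond; apply: eq_integral => x _.
  rewrite patchE indicE; case: ifPn => _; first by rewrite mul1e.
  by rewrite mul0e.
- apply: emeasurable_funM => //; exact/measurable_EFinP.
- by move=> x _; rewrite mule_ge0// lee_fin.
Qed.

End density.

Section prod_dirac.
Local Open Scope ereal_scope.
Context d1 d2 (T1 : measurableType d1) (T2 : measurableType d2) (R : realType).
Variables (mu : {measure set T1 -> \bar R}) (a : T2).

Lemma measurable_pairr : measurable_fun [set: T1] (fun x : T1 => (x, a)).
Proof. exact: measurable_fun_pair. Qed.

(** A product with a point mass is an image measure under x |-> (x, a), computed
    here on sets so that it applies to an arbitrary improper prior [mu]. *)
Lemma product_dirac_pushforward (A : set (T1 * T2)) : measurable A ->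
  (mu \x \d_a) A = pushforward mu (fun x => (x, a)) A.
Proof.
move=> mA; rewrite /product_measure1/= /pushforward.
transitivity (\int[mu]_x (\1_((fun x => (x, a)) @^-1` A) x)%:E); last first.
  rewrite integral_indic ?setIT//.
  by rewrite -[X in measurable X]setTI; exact: measurable_pairr.
apply: eq_integral => x _ /=; rewrite diracE indicE.
congr ((nat_of_bool _)%:R%:E); apply/idP/idP.
  by rewrite !inE/= /xsection/= inE.
by rewrite !inE/= /xsection/= inE.
Qed.

Lemma ge0_integral_prod_dirac (f : T1 * T2 -> \bar R) :
  measurable_fun setT f -> (forall x, 0 <= f x) ->
  \int[mu \x \d_a]_x f x = \int[mu]_x f (x, a).
Proof.
move=> mf f0.
transitivity (\int[pushforward mu (fun x => (x, a))]_x f x).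
  apply: eq_measure_integral => A mA _; exact: product_dirac_pushforward.
by rewrite ge0_integral_pushforward//; exact: measurable_pairr.
Qed.

Lemma integral_prod_dirac (f : T1 * T2 -> \bar R) : measurable_fun setT f ->
  \int[mu \x \d_a]_x f x = \int[mu]_x f (x, a).
Proof.
move=> mf; rewrite [LHS]integralE [RHS]integralE; congr (_ - _).
  by rewrite ge0_integral_prod_dirac//;
    [by apply: eq_integral => x _; rewrite !funeposE|exact: measurable_funepos].
by rewrite ge0_integral_prod_dirac//;
  [by apply: eq_integral => x _; rewrite !funenegE|exact: measurable_funeneg].
Qed.

Lemma integrable_prod_dirac (f : T1 * T2 -> \bar R) : measurable_fun setT f ->
  mu.-integrable setT (fun x => f (x, a)) ->
  (mu \x \d_a).-integrable setT f.
Proof.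
move=> mf /integrableP[_ fi]; apply/integrableP; split=> //.
by rewrite ge0_integral_prod_dirac//; exact: measurableT_comp.
Qed.

End prod_dirac.

(** * Linear changes of variables for Lebesgue measure on column vectors *)

Section affine_line.
Local Open Scope ereal_scope.
Context {R : realType}.
Local Notation leb := (@lebesgue_measure R).

Lemma measurable_affine (a b : R) :
  measurable_fun setT (fun x : measurableTypeR R => (a * x + b)%R : measurableTypeR R).
Proof. by apply: measurable_funD => //; exact: measurable_funM. Qed.

Let affine_gt0 (a b : R) (f : R -> \bar R) : (0 < a)%R ->
  measurable_fun [set: measurableTypeR R] f -> (forall x, 0 <= f x) ->
  \int[leb]_x f x = a%:E * \int[leb]_x f (a * x + b)%R.
Proof.
move=> a0 mf f0.
pose phi (x : measurableTypeR R) : measurableTypeR R := (a * x + b)%R.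
have mphi : measurable_fun setT phi by exact: measurable_affine.
have ag0 : (0 <= a)%R by exact: ltW.
pose nu : {measure set (measurableTypeR R) -> \bar R} :=
  [the measure _ _ of mscale (NngNum ag0)
     (measure_function_pushforward__canonical__measure_function_Measure leb mphi)].
have leb_nu A : measurable A -> leb A = nu A.
  apply: lebesgue_measure_unique => _ [[u v] _ <-].
  rewrite /nu /= /mscale /= /pushforward.
  have -> : phi @^-1` [set` `]u, v]] = [set` `](u - b) / a, (v - b) / a]]%R.
    apply/seteqP; split=> x; rewrite /phi /= !in_itv /=;
      by rewrite ltr_pdivrMr// ler_pdivlMr// ltrBlDr lerBrDr (mulrC x).
  rewrite !lebesgue_measure_itv/= !lte_fin ltr_pM2r ?invr_gt0// ltrD2r.
  case: ifPn => _; last by rewrite mule0.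
  rewrite -!EFinB -EFinM; congr EFin; field; exact: lt0r_neq0.
rewrite (@eq_measure_integral _ _ _ _ nu)//; last by move=> A mA _; exact: leb_nu.
rewrite ge0_integral_mscale//; congr (_ * _).
by rewrite ge0_integral_pushforward.
Qed.

(** Both measures agree on half-open intervals when a > 0; the case a < 0
    follows by the invariance of Lebesgue measure under x |-> - x. *)
Lemma ge0_integral_affine (a b : R) (f : R -> \bar R) : a != 0%R ->
  measurable_fun [set: measurableTypeR R] f -> (forall x, 0 <= f x) ->
  \int[leb]_x f (a * x + b)%R = (`|a|^-1)%:E * \int[leb]_x f x.
Proof.
have pos c g : (0 < c)%R ->
    measurable_fun [set: measurableTypeR R] g -> (forall x, 0 <= g x) ->
    \int[leb]_x g (c * x + b)%R = (c^-1)%:E * \int[leb]_x g x.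
  move=> c0 mg g0; rewrite (affine_gt0 b c0 mg g0) muleA -EFinM mulVf ?mul1e//.
  exact: lt0r_neq0.
rewrite neq_lt => /orP[a0|a0] mf f0; last by rewrite pos// gtr0_norm.
have an0 : (0 < - a)%R by rewrite oppr_gt0.
rewrite ltr0_norm// -pos//.
have mN : measurable_fun setT (-%R : measurableTypeR R -> measurableTypeR R).
  exact: oppr_measurable.
transitivity (\int[pushforward leb (-%R : _ -> measurableTypeR R)]_x f (a * x + b)%R).
  apply/esym/eq_measure_integral => A mA _; exact: lebesgue_measureN.
rewrite ge0_integral_pushforward//.
  by apply: eq_integral => x _ /=; congr f; rewrite mulrN mulNr.
by apply: (measurableT_comp mf); exact: measurable_affine.
Qed.

End affine_line.

Section measurable_cV_ops.
Context {R : realType} d (T : measurableType d).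

Lemma measurable_mulmx m n (A : 'M[R]_(m, n)) (f : T -> 'cV[R]_n) :
  measurable_fun setT f -> measurable_fun setT (fun t => A *m f t).
Proof.
move=> /measurable_fun_cVP mf; apply/measurable_fun_cVP => i.
under eq_fun do rewrite mxE.
by apply: measurable_sum => j; apply: measurable_funM.
Qed.

Lemma measurable_addmx n (f g : T -> 'cV[R]_n) :
  measurable_fun setT f -> measurable_fun setT g ->
  measurable_fun setT (fun t => f t + g t).
Proof.
move=> /measurable_fun_cVP mf /measurable_fun_cVP mg.
apply/measurable_fun_cVP => i.
under eq_fun do rewrite mxE.
by apply: measurable_funD.
Qed.

Lemma measurable_oppmx n (f : T -> 'cV[R]_n) :
  measurable_fun setT f -> measurable_fun setT (fun t => - f t).
Proof.
move=> mf; have := measurable_mulmx (- 1%:M) mf.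
by under eq_fun do rewrite mulNmx mul1mx.
Qed.

Lemma measurable_submx n (f g : T -> 'cV[R]_n) :
  measurable_fun setT f -> measurable_fun setT g ->
  measurable_fun setT (fun t => f t - g t).
Proof. by move=> mf mg; apply: measurable_addmx => //; exact: measurable_oppmx. Qed.

Lemma measurable_col_mx m n (f : T -> 'cV[R]_m) (g : T -> 'cV[R]_n) :
  measurable_fun setT f -> measurable_fun setT g ->
  measurable_fun setT (fun t => col_mx (f t) (g t)).
Proof.
move=> /measurable_fun_cVP mf /measurable_fun_cVP mg.
apply/measurable_fun_cVP => i; case: (split_ordP i) => j ->.
  by under eq_fun do rewrite col_mxEu; exact: mf.
by under eq_fun do rewrite col_mxEd; exact: mg.
Qed.

Lemma measurable_usubmx m n (f : T -> 'cV[R]_(m + n)) :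
  measurable_fun setT f -> measurable_fun setT (fun t => usubmx (f t)).
Proof.
move=> /measurable_fun_cVP mf; apply/measurable_fun_cVP => i.
by under eq_fun do rewrite mxE; exact: mf.
Qed.

Lemma measurable_dsubmx m n (f : T -> 'cV[R]_(m + n)) :
  measurable_fun setT f -> measurable_fun setT (fun t => dsubmx (f t)).
Proof.
move=> /measurable_fun_cVP mf; apply/measurable_fun_cVP => i.
by under eq_fun do rewrite mxE; exact: mf.
Qed.

Lemma measurable_sqnorm n (f : T -> 'cV[R]_n) :
  measurable_fun setT f -> measurable_fun setT (fun t => sqnorm (f t)).
Proof.
move=> mf; have := measurable_qform 1%:M mf.
by rewrite /qform /sqnorm; under eq_fun do rewrite mulmx1.
Qed.

Lemma measurable_sqnormE n (f : T -> 'cV[R]_n) :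
  measurable_fun setT f -> measurable_fun setT (fun t => (sqnorm (f t))%:E).
Proof. by move=> mf; apply/measurable_EFinP; exact: measurable_sqnorm. Qed.

End measurable_cV_ops.

Section change_of_variables.
Local Open Scope ereal_scope.
Context {R : realType}.
Local Notation leb := (@lebesgue_measure R).

Lemma ge0_integral_cV_cons n (f : 'cV[R]_n.+1 -> \bar R) :
  measurable_fun setT f -> (forall v, 0 <= f v) ->
  \int[lebesgue_cV n.+1]_v f v =
  \int[leb]_x \int[lebesgue_cV n]_v f (cV_cons (x, v)).
Proof.
move=> mf f0; have mc := @measurable_cV_cons R n.
transitivity (\int[pushforward (leb \x lebesgue_cV n) (@cV_cons R n)]_v f v) => //.
rewrite ge0_integral_pushforward// preimage_setT.
rewrite (fubini_tonelli1 (f \o @cV_cons R n))//.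
  exact: (measurableT_comp mf).
by move=> x; exact: f0.
Qed.

Lemma ge0_integral_cV_consC n (f : 'cV[R]_n.+1 -> \bar R) :
  measurable_fun setT f -> (forall v, 0 <= f v) ->
  \int[lebesgue_cV n.+1]_v f v =
  \int[lebesgue_cV n]_v \int[leb]_x f (cV_cons (x, v)).
Proof.
move=> mf f0; rewrite ge0_integral_cV_cons//.
rewrite (fubini_tonelli (f \o @cV_cons R n))//; last by move=> x; exact: f0.
by apply: (measurableT_comp mf); exact: measurable_cV_cons.
Qed.

Lemma measurable_cV_consl n (v : 'cV[R]_n) :
  measurable_fun setT (fun x : measurableTypeR R => cV_cons (x, v)).
Proof. by apply: (measurableT_comp (@measurable_cV_cons R n)); exact: measurable_fun_pair. Qed.

Lemma measurable_cV_consr n (x : measurableTypeR R) :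
  measurable_fun setT (fun v : 'cV[R]_n => cV_cons (x, v)).
Proof. by apply: (measurableT_comp (@measurable_cV_cons R n)); exact: measurable_fun_pair. Qed.

Lemma cV_consD n (x y : R) (v w : 'cV[R]_n) :
  (cV_cons (x, v) + cV_cons (y, w) = cV_cons ((x + y)%R, (v + w)%R))%R.
Proof. by rewrite /cV_cons [LHS](@add_col_mx _ 1 n 1) -raddfD. Qed.

Lemma cV_consP n (v : 'cV[R]_n.+1) : exists x w, v = cV_cons (x, w).
Proof.
exists (v ord0 0%R), (\col_i v (lift ord0 i) 0%R)%R; apply/colP => i.
by case: (unliftP ord0 i) => [j|] ->; rewrite ?cV_consES ?cV_consE0 ?mxE.
Qed.

Lemma mul_block_cV_cons n (a : R) (r : 'rV[R]_n) (c : 'cV[R]_n) (L : 'M[R]_n)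
    (x : R) (v : 'cV[R]_n) :
  (block_mx (a%:M : 'M[R]_1) r c L *m cV_cons (x, v) : 'cV[R]_n.+1) =
  cV_cons ((a * x + (r *m v) 0 0)%R, (x *: c + L *m v)%R).
Proof.
have e : (a%:M *m x%:M + r *m v = (a * x + (r *m v) 0 0)%:M :> 'M[R]_1)%R.
  by rewrite raddfD/= -mx11_scalar scalar_mxM.
by rewrite /cV_cons [LHS](@mul_block_col _ 1 n 1 n 1)/= e mul_mx_scalar.
Qed.

(** Induction on the dimension, one coordinate at a time. *)
Lemma ge0_integral_cV_translate n (c : 'cV[R]_n) (f : 'cV[R]_n -> \bar R) :
  measurable_fun setT f -> (forall v, 0 <= f v) ->
  \int[lebesgue_cV n]_v f (v + c)%R = \int[lebesgue_cV n]_v f v.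
Proof.
elim: n c f => [|n IHn] c f mf f0.
  by apply: eq_integral => v _; congr f; apply/colP => -[].
have [y [w ->]] := cV_consP c.
rewrite ge0_integral_cV_cons//; last first.
  by apply: (measurableT_comp mf); exact: measurable_addmx.
pose F (x : measurableTypeR R) := \int[lebesgue_cV n]_v f (cV_cons (x, v)).
have mF : measurable_fun setT F.
  apply: (measurable_fun_fubini_tonelli_F (f \o @cV_cons R n)) => [|x]; last exact: f0.
  by apply: (measurableT_comp mf); exact: measurable_cV_cons.
transitivity (\int[leb]_x F (1 * x + y)%R).
  apply: eq_integral => x _; under eq_integral do rewrite cV_consD.
  rewrite /F mul1r (IHn w (fun v => f (cV_cons ((x + y)%R, v))))//.
  by apply: (measurableT_comp mf); exact: measurable_cV_consr.
rewrite (ge0_integral_affine _ _ mF)//; last by move=> x; exact: integral_ge0.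
by rewrite normr1 invr1 mul1e ge0_integral_cV_cons.
Qed.

(** The change of variables formula for [A], as a property to be propagated
    through matrix factorizations. *)
Definition linear_change n (A : 'M[R]_n) := forall f : 'cV[R]_n -> \bar R,
  measurable_fun setT f -> (forall v, 0 <= f v) ->
  \int[lebesgue_cV n]_v f (A *m v)%R =
  (`|\det A|^-1)%:E * \int[lebesgue_cV n]_v f v.

Lemma linear_changeM n (A B : 'M[R]_n) :
  linear_change A -> linear_change B -> linear_change (A *m B)%R.
Proof.
move=> cA cB f mf f0; under eq_integral do rewrite -mulmxA.
rewrite (cB (fun v => f (A *m v)%R))//; last first.
  by apply: (measurableT_comp mf); exact: measurable_mulmx.
by rewrite cA// muleA -EFinM det_mulmx normrM invfM mulrC.
Qed.

(** Given the first coordinate x, the remaining coordinates undergo L followed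
    by the translation by x c; then only a scaling of x is left. *)
Lemma linear_change_lower n (a : R) (c : 'cV[R]_n) (L : 'M[R]_n) :
  a != 0%R -> linear_change L ->
  linear_change (block_mx (a%:M : 'M[R]_1) 0 c L : 'M[R]_n.+1).
Proof.
move=> a0 cL f mf f0.
rewrite ge0_integral_cV_cons//; last first.
  by apply: (measurableT_comp mf); exact: measurable_mulmx.
pose F (x : measurableTypeR R) := \int[lebesgue_cV n]_v f (cV_cons (x, v)).
have mF : measurable_fun setT F.
  apply: (measurable_fun_fubini_tonelli_F (f \o @cV_cons R n)) => [|x]; last exact: f0.
  by apply: (measurableT_comp mf); exact: measurable_cV_cons.
have F0 x : 0 <= F x by exact: integral_ge0.
transitivity (\int[leb]_x ((`|\det L|^-1)%:E *
   F (a * x + 0)%R)).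
  apply: eq_integral => x _.
  under eq_integral do rewrite mul_block_cV_cons mul0mx mxE.
  pose g v := f (cV_cons ((a * x + 0)%R, v)).
  have mg : measurable_fun setT g.
    by apply: (measurableT_comp mf); exact: measurable_cV_consr.
  have mgc : measurable_fun setT (fun v => g (x *: c + v)%R).
    by apply: (measurableT_comp mg); exact: measurable_addmx.
  have g0 v : 0 <= g v by exact: f0.
  rewrite (cL (fun v => g (x *: c + v)%R))//; congr (_ * _).
  rewrite (eq_integral (fun v : 'cV[R]_n => g (v + x *: c)%R)).
    by rewrite ge0_integral_cV_translate.
  by move=> v _; rewrite addrC.
rewrite ge0_integralZl//; last exact: (measurableT_comp mF (measurable_affine a 0)).
rewrite (ge0_integral_affine _ _ mF)// muleA -EFinM ge0_integral_cV_cons//.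
by rewrite (@det_lblock _ 1) det_scalar1 normrM invfM mulrC.
Qed.

(** Same argument with the order of integration reversed: given the last
    coordinates v, the first one undergoes the affine map x |-> a x + r v. *)
Lemma linear_change_upper n (a : R) (r : 'rV[R]_n) (U : 'M[R]_n) :
  a != 0%R -> linear_change U ->
  linear_change (block_mx (a%:M : 'M[R]_1) r 0 U : 'M[R]_n.+1).
Proof.
move=> a0 cU f mf f0.
rewrite ge0_integral_cV_consC//; last first.
  by apply: (measurableT_comp mf); exact: measurable_mulmx.
pose G (v : 'cV[R]_n) := \int[leb]_x f (cV_cons (x, v)).
have mG : measurable_fun setT G.
  apply: (measurable_fun_fubini_tonelli_G (f \o @cV_cons R n)) => [|x]; last exact: f0.
  by apply: (measurableT_comp mf); exact: measurable_cV_cons.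
have G0 v : 0 <= G v by exact: integral_ge0.
transitivity (\int[lebesgue_cV n]_v ((`|a|^-1)%:E * G (U *m v)%R)).
  apply: eq_integral => v _.
  under eq_integral do rewrite mul_block_cV_cons scaler0 add0r.
  pose g (x : measurableTypeR R) := f (cV_cons (x, (U *m v)%R)).
  have mg : measurable_fun setT g.
    by apply: (measurableT_comp mf); exact: measurable_cV_consl.
  by rewrite (ge0_integral_affine _ _ mg)// => x; exact: f0.
rewrite ge0_integralZl//; last first.
  by apply: (measurableT_comp mG); exact: measurable_mulmx.
rewrite cU// muleA -EFinM ge0_integral_cV_consC//.
by rewrite (@det_ublock _ 1) det_scalar1 normrM invfM.
Qed.

Lemma linear_change1 n : linear_change (1%:M : 'M[R]_n).
Proof.
by move=> f mf f0; under eq_integral do rewrite mul1mx; rewrite det1 normr1 invr1 mul1e.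
Qed.

(** Gaussian elimination, by induction on the dimension.  A nonzero pivot gives
    a factorization into a lower and an upper block triangular matrix, to which
    the two previous lemmas apply.  If the pivot vanishes, some other entry of
    the first column does not, and adding its row to the first one is an upper
    block triangular operation; so no permutation matrix occurs. *)
Lemma ge0_integral_linear_change n (A : 'M[R]_n) :
  A \in unitmx -> linear_change A.
Proof.
elim: n A => [|n IHn] A uA.
  have -> : A = 1%:M by apply/matrixP => -[].
  exact: linear_change1.
have pivot (B : 'M[R]_n.+1) : B \in unitmx -> B ord0 ord0 != 0%R -> linear_change B.
  have [a [r [c [D ->]]]] : exists (a : 'M[R]_1) (r : 'rV[R]_n) (c : 'cV[R]_n)
      (D : 'M[R]_n), B = block_mx a r c D.
    exists (@ulsubmx _ 1 n 1 n B), (@ursubmx _ 1 n 1 n B).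
    exists (@dlsubmx _ 1 n 1 n B), (@drsubmx _ 1 n 1 n B).
    exact: (esym (@submxK _ 1 n 1 n B)).
  move=> uB.
  have -> : ord0 = lshift n (0%R : 'I_1) :> 'I_n.+1 by exact: val_inj.
  rewrite (@block_mxEul _ 1 n 1 n) => a0.
  have aE : a = (a 0 0)%:M%R by exact: mx11_scalar.
  set b := a 0%R 0%R in a0 aE.
  (* Schur complement of the pivot b. *)
pose E := (D - b^-1 *: (c *m r))%R.
  have BE : block_mx a r c D =
      (block_mx (1%:M : 'M[R]_1) 0 (b^-1 *: c) 1%:M) *m
      (block_mx (b%:M : 'M[R]_1) r 0 E) :> 'M[R]_(1 + n).
    rewrite mulmx_block !mul1mx !mul0mx !addr0 -aE; congr block_mx.
      by rewrite aE mul_mx_scalar scalerA divff// scale1r.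
    by rewrite -scalemxAl /E addrC subrK.
  move: uB; rewrite BE (@unitmx_mul _ (1 + n)) => /andP[_].
  rewrite (@unitmxE _ (1 + n)) (@det_ublock _ 1) unitrM => /andP[_].
  rewrite -unitmxE => /IHn cE.
  apply: linear_changeM; last exact: linear_change_upper.
  by apply: linear_change_lower; [exact: oner_neq0|exact: linear_change1].
have [A00|] := eqVneq (A ord0 ord0) 0%R; last exact: pivot.
have [i Ai] : exists i, A (lift ord0 i) ord0 != 0%R.
  apply/existsP; apply: contraLR uA => /existsPn A0.
  rewrite unitmxE unitfE negbK; apply/eqP.
  rewrite (expand_det_col _ ord0) big1// => j _.
  case: (unliftP ord0 j) => [k|] ->; last by rewrite A00 mul0r.
  by have /negPn/eqP -> := A0 k; rewrite mul0r.
(* T 1 adds row i + 1 to row 0, and T (- 1) undoes it. *)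
pose T s : 'M[R]_n.+1 := block_mx (1%:M : 'M[R]_1) (s *: delta_mx 0 i)%R 0 1%:M.
have TT : (T (-1) *m T 1)%R = 1%:M.
  rewrite /T [LHS](@mulmx_block _ 1 n 1 n 1 n) !mul1mx !mulmx1 !mulmx0 !mul0mx.
  by rewrite !addr0 !add0r scaleN1r scale1r subrr -(@scalar_mx_block _ 1 n).
have cT s : linear_change (T s).
  by apply: linear_change_upper; [exact: oner_neq0|exact: linear_change1].
have -> : A = (T (-1) *m (T 1 *m A))%R by rewrite mulmxA TT mul1mx.
apply: linear_changeM => //; apply: pivot.
  by rewrite unitmx_mul uA andbT; case: (mulmx1_unit TT).
have Trow j : T 1%R ord0 (lift ord0 j) = ((j == i)%:R)%R.
  rewrite /T (_ : ord0 = lshift n (0%R : 'I_1)); last exact: val_inj.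
  rewrite (_ : lift _ j = rshift 1 j); last exact: val_inj.
  by rewrite (@block_mxEur _ 1 n 1 n) scale1r mxE.
rewrite mxE big_ord_recl A00 mulr0 add0r (bigD1 i)//= big1 => [|j /negbTE ji].
  by rewrite addr0 Trow eqxx mul1r.
by rewrite Trow ji mul0r.
Qed.

End change_of_variables.

Section col_mx_tonelli.
Local Open Scope ereal_scope.
Context {R : realType}.

Lemma cV_cons_col_mx m n (t : R) (x : 'cV[R]_m) (y : 'cV[R]_n) :
  cV_cons (t, col_mx x y) = col_mx (cV_cons (t, x)) y :> 'cV[R]_(m.+1 + n).
Proof.
apply/colP => i; case: (split_ordP i) => j ->.
  rewrite col_mxEu; case: (unliftP ord0 j) => [k|] ->.
    rewrite cV_consES.
    rewrite (_ : @lshift m.+1 n _ = lift ord0 (lshift n (k : 'I_m) : 'I_(m + n)));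
      last exact: val_inj.
    by rewrite (cV_consES (n := m + n)) col_mxEu.
  rewrite cV_consE0 (_ : @lshift m.+1 n _ = ord0 :> 'I_(m + n).+1); last exact: val_inj.
  by rewrite (cV_consE0 (n := m + n)).
rewrite col_mxEd (_ : @rshift m.+1 n j = lift ord0 (rshift m j : 'I_(m + n)));
  last exact: val_inj.
by rewrite (cV_consES (n := m + n)) col_mxEd.
Qed.

Lemma measurable_col_mx_pair m n :
  measurable_fun setT (fun p : 'cV[R]_m * 'cV[R]_n => col_mx p.1 p.2).
Proof. by apply: measurable_col_mx. Qed.

Lemma measurable_col_mxr m n (x : 'cV[R]_m) :
  measurable_fun setT (fun y : 'cV[R]_n => col_mx x y).
Proof. by apply: measurable_col_mx. Qed.

(** Peels off the coordinates of the first block one by one. *)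
Lemma ge0_integral_lebesgue_col_mx m n (f : 'cV[R]_(m + n) -> \bar R) :
  measurable_fun setT f -> (forall v, 0 <= f v) ->
  \int[lebesgue_cV (m + n)]_v f v =
  \int[lebesgue_cV m]_x \int[lebesgue_cV n]_y f (col_mx x y).
Proof.
elim: m f => [|m IHm] f mf f0.
  rewrite [RHS]integral_dirac//=.
    rewrite diracT mul1e; apply: eq_integral => v _; congr f; apply/colP => i.
    by rewrite (_ : i = rshift 0 i) ?col_mxEd//; [congr (v _ _)|]; exact: val_inj.
  apply: (measurable_fun_fubini_tonelli_F (fun p => f (col_mx p.1 p.2))) => //.
  by apply: (measurableT_comp mf); exact: measurable_col_mx_pair.
rewrite [LHS]ge0_integral_cV_cons// [RHS]ge0_integral_cV_cons; last 2 first.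
- apply: (measurable_fun_fubini_tonelli_F (fun p => f (col_mx p.1 p.2))) => //.
  by apply: (measurableT_comp mf); exact: measurable_col_mx_pair.
- by move=> x; exact: integral_ge0.
apply: eq_integral => t _.
have mft : measurable_fun setT (fun v => f (cV_cons (t, v))).
  by apply: (measurableT_comp mf); exact: measurable_cV_consr.
apply: (etrans (IHm _ mft (fun v => f0 _))).
apply: eq_integral => x _; apply: eq_integral => y _.
by congr f; exact: cV_cons_col_mx.
Qed.

End col_mx_tonelli.

(** * Euclidean norm, quadratic forms and positive definite matrices *)

Section posdef.
Context {R : realType}.

Lemma qformE n (Q : 'M[R]_n) (v : 'cV[R]_n) : qform Q v = (v^T *m (Q *m v)) 0 0.
Proof. by rewrite /qform mulmxA. Qed.

Lemma sqnormE n (v : 'cV[R]_n) : sqnorm v = \sum_i v i 0 ^+ 2.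
Proof. by rewrite /sqnorm mxE; apply: eq_bigr => i _; rewrite mxE expr2. Qed.

Lemma sqnorm_ge0 n (v : 'cV[R]_n) : 0 <= sqnorm v.
Proof. by rewrite sqnormE sumr_ge0// => i _; rewrite sqr_ge0. Qed.

Lemma sqnorm_eq0 n (v : 'cV[R]_n) : (sqnorm v == 0) = (v == 0).
Proof.
apply/idP/eqP => [|->]; last by rewrite /sqnorm mulmx0 mxE.
rewrite sqnormE psumr_eq0 => [/allP v0|i _]; last exact: sqr_ge0.
apply/colP => i; rewrite mxE; apply/eqP; rewrite -sqrf_eq0.
by apply: v0; rewrite mem_index_enum.
Qed.

Lemma qform_congr m n (M : 'M[R]_(m, n)) (Q : 'M[R]_n) (v : 'cV[R]_m) :
  qform (M *m Q *m M^T) v = qform Q (M^T *m v).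
Proof. by rewrite /qform trmx_mul trmxK !mulmxA. Qed.

Lemma qform_sqnorm m n (M : 'M[R]_(m, n)) (v : 'cV[R]_n) :
  qform (M^T *m M) v = sqnorm (M *m v).
Proof. by rewrite /qform /sqnorm trmx_mul !mulmxA. Qed.

Lemma posdefmx_congr m n (M : 'M[R]_(m, n)) (Q : 'M[R]_n) :
  (forall v : 'cV[R]_m, M^T *m v = 0 -> v = 0) -> posdefmx Q ->
  posdefmx (M *m Q *m M^T).
Proof.
move=> Minj [sQ Q0]; split=> [|v v0].
  by rewrite !trmx_mul trmxK sQ mulmxA.
by rewrite qform_congr Q0//; apply: contra_neq v0; exact: Minj.
Qed.

Lemma posdefmx_congr_unit n (M : 'M[R]_n) (Q : 'M[R]_n) :
  M \in unitmx -> posdefmx Q -> posdefmx (M *m Q *m M^T).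
Proof.
move=> uM; apply: posdefmx_congr => v Mv.
by rewrite -(mulKmx (_ : M^T \in unitmx) v) ?unitmx_tr// Mv mulmx0.
Qed.

Lemma posdefmx_unit n (Q : 'M[R]_n) : posdefmx Q -> Q \in unitmx.
Proof.
move=> [sQ Q0]; rewrite -row_free_unit -kermx_eq0; apply/eqP/row_matrixP => i.
rewrite row0; set r := row i _; apply: trmx_inj; rewrite trmx0; apply/eqP.
apply: contraT => /Q0; rewrite /qform trmxK.
have -> : r *m Q = 0 by apply/sub_kermxP; exact: row_sub.
by rewrite mul0mx mxE ltxx.
Qed.

Lemma posdefmx_scale n (c : R) (Q : 'M[R]_n) : 0 < c -> posdefmx Q -> posdefmx (c *: Q).
Proof.
move=> c0 [sQ Q0]; split=> [|v /Q0 v0]; first by rewrite linearZ/= sQ.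
by rewrite /qform -scalemxAr -scalemxAl mxE mulr_gt0.
Qed.

Lemma posdefmx_diag n (d : 'rV[R]_n) : (forall i, 0 < d 0 i) -> posdefmx (diag_mx d).
Proof.
move=> d0; split=> [|v v0]; first by rewrite tr_diag_mx.
have qE : qform (diag_mx d) v = \sum_i d 0 i * v i 0 ^+ 2.
  rewrite qformE mxE; apply: eq_bigr => i _.
  by rewrite mul_diag_mx !mxE; ring.
rewrite qE lt_neqAle sumr_ge0 ?andbT => [|i _]; last by rewrite mulr_ge0 ?sqr_ge0// ltW.
apply: contra_neq v0 => /esym/eqP; rewrite psumr_eq0 => [/allP e0|i _]; last first.
  by rewrite mulr_ge0 ?sqr_ge0// ltW.
apply/colP => i; rewrite mxE; apply/eqP; rewrite -sqrf_eq0.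
have := e0 i; rewrite mem_index_enum mulf_eq0 => /(_ isT).
by rewrite (gt_eqF (d0 i)).
Qed.

Lemma posdefmx_block m n (V1 : 'M[R]_m) (V2 : 'M[R]_n) :
  posdefmx (block_mx V1 0 0 V2) -> posdefmx V1 /\ posdefmx V2.
Proof.
move=> [sV V0]; move: sV; rewrite tr_block_mx => /eq_block_mx[s1 _ _ s2].
have qE x y : qform (block_mx V1 0 0 V2) (col_mx x y) = qform V1 x + qform V2 y.
  rewrite qformE mul_block_col !mul0mx addr0 add0r tr_col_mx mul_row_col mxE.
  by rewrite !qformE.
have q0 k (Q : 'M[R]_k) : qform Q 0 = 0 by rewrite /qform mulmx0 mxE.
split; split=> // v v0.
  have := V0 (col_mx v 0); rewrite qE q0 addr0; apply.
  by apply: contra_neq v0; rewrite -col_mx0 => /eq_col_mx[].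
have := V0 (col_mx 0 v); rewrite qE q0 add0r; apply.
by apply: contra_neq v0; rewrite -col_mx0 => /eq_col_mx[].
Qed.

(** Block elimination: T V T^T is the block diagonal matrix of the Schur
    complement and of the lower right block.  With V the covariance of (z1, z2),
    this is what makes z4 and z2 independent. *)
Lemma posdefmx_elim m n (V : 'M[R]_(m + n)) (K : 'M[R]_(m, n)) :
  posdefmx V -> K = ursubmx V *m invmx (drsubmx V) ->
  let T : 'M[R]_(m + n) := block_mx 1%:M (- K) 0 1%:M in
  drsubmx V \in unitmx /\
  T *m V *m T^T = block_mx (ulsubmx V - K *m dlsubmx V) 0 0 (drsubmx V).
Proof.
move=> pV -> T.
have pV22 : posdefmx (drsubmx V).
  have -> : drsubmx V = row_mx 0 1%:M *m V *m (row_mx 0 1%:M)^T.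
    rewrite -[in RHS](submxK V) tr_row_mx mul_row_block mul_row_col.
    by rewrite !mul0mx !add0r !mul1mx !trmx1 mulmx1 trmx0 mulmx0 add0r.
  apply: posdefmx_congr => // v; rewrite tr_row_mx trmx0 trmx1 mul_col_mx.
  by rewrite mul0mx mul1mx -col_mx0 => /eq_col_mx[].
have u22 := posdefmx_unit pV22; split=> //.
have [sV _] := pV.
have s22 : (drsubmx V)^T = drsubmx V by rewrite trmx_drsub sV.
have s12 : (ursubmx V)^T = dlsubmx V by rewrite trmx_ursub sV.
rewrite -[X in _ *m X *m _](submxK V) /T.
move: u22 s22 s12 {T pV pV22 sV}.
move: (ulsubmx V) (ursubmx V) (dlsubmx V) (drsubmx V) => a r c e ue se sr.
rewrite tr_block_mx !trmx1 trmx0 linearN/= trmx_mul trmx_inv se sr.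
rewrite !mulmx_block !mul1mx !mul0mx !mulmx1 !mulmx0 !mulNmx !mulmxN !add0r.
by rewrite mulmxKV// subrr mul0mx subr0 mulKVmx// subrr.
Qed.

End posdef.

(** * Means of random vectors *)

Section jensen.
Context d (T : measurableType d) (R : realType).
Variable P : {measure set T -> \bar R}.
Hypothesis P1 : P setT = 1%E.

Let integrable_cst (r : R) : P.-integrable setT (EFin \o cst r).
Proof.
apply/integrableP; split; first exact/measurable_EFinP.
rewrite (eq_integral (cst `|r%:E|%E))//.
by rewrite integral_cst// P1 mule1 abse_EFin ltry.
Qed.

(** Jensen for the square.  With c the mean of h - t, integrate
    2 c (h - t) - c^2 <= (h - t)^2.  A finite right-hand side makes h
    integrable, and with an infinite one there is nothing to prove. *)
Lemma sqr_mean_sub_le (h : T -> R) (t : R) : measurable_fun setT h ->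
  (((\int[P]_x h x - t) ^+ 2)%:E <= \int[P]_x ((h x - t) ^+ 2)%:E)%E.
Proof.
move=> mh.
have mg : measurable_fun setT (fun x => h x - t) by exact: measurable_funB.
have mg2 : measurable_fun setT (fun x => (h x - t) ^+ 2).
  exact: measurable_funX.
have [->|Ifin] := eqVneq (\int[P]_x ((h x - t) ^+ 2)%:E)%E +oo%E; first exact: leey.
have ig2 : P.-integrable setT (fun x => ((h x - t) ^+ 2)%:E).
  apply/integrableP; split; first exact/measurable_EFinP.
  under eq_integral do rewrite /= ger0_norm ?sqr_ge0//.
  by rewrite ltey.
have ig : P.-integrable setT (EFin \o (fun x => h x - t)).
  apply: (@le_integrable _ _ _ _ _ measurableT _ (fun x => (1 + (h x - t) ^+ 2)%:E)).
  - exact/measurable_EFinP.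
  - move=> x _; rewrite /= lee_fin [leRHS]ger0_norm ?addr_ge0 ?sqr_ge0//.
    (* |g| <= 1 + g^2 for g = h x - t *)
    have := sqr_ge0 (`|h x - t| - 1); rewrite sqrrB1 real_normK ?num_real//.
    have := normr_ge0 (h x - t); lra.
  - apply: (eq_integrable measurableT (fun x => 1%:E + ((h x - t) ^+ 2)%:E)%E) => //.
    by apply: integrableD => //; exact: integrable_cst.
have ih : P.-integrable setT (EFin \o h).
  apply: (eq_integrable measurableT (fun x => (h x - t)%:E + t%:E)%E) => //.
    by move=> x _; rewrite /= -EFinD subrK.
  by apply: integrableD => //; exact: integrable_cst.
set c := \int[P]_x h x - t.
have cE : c = \int[P]_x (h x - t).
  rewrite RintegralB//; last exact: integrable_cst.
  by rewrite Rintegral_cst// P1 mulr1.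
have i2c : P.-integrable setT (EFin \o (fun x => 2 * c * (h x - t))).
  apply: (eq_integrable measurableT (fun x => (2 * c)%:E * (h x - t)%:E)%E) => //.
  exact: integrableZl.
have icc := integrable_cst (c ^+ 2).
have : \int[P]_x (2 * c * (h x - t) - c ^+ 2) <= \int[P]_x ((h x - t) ^+ 2).
  apply: le_Rintegral => //.
    apply: (eq_integrable measurableT (fun x => (2 * c * (h x - t))%:E - (c ^+ 2)%:E)%E) => //.
    exact: integrableB.
  by move=> x _; have := sqr_ge0 (h x - t - c); rewrite sqrrB; lra.
rewrite RintegralB// RintegralZl// -cE Rintegral_cst// P1 mulr1 => le2.
rewrite -[leRHS]fineK; last exact: integrable_fin_num ig2.
rewrite lee_fin; apply: le_trans le2.
by rewrite expr2; lra.
Qed.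

Definition meanvec n (g : T -> 'cV[R]_n) : 'cV[R]_n := \col_i \int[P]_x g x i 0.

Lemma sqnorm_meanvec_sub_le n (g : T -> 'cV[R]_n) (t : 'cV[R]_n) :
  measurable_fun setT g ->
  ((sqnorm (meanvec g - t))%:E <= \int[P]_x (sqnorm (g x - t))%:E)%E.
Proof.
move=> /measurable_fun_cVP mg.
have -> : (\int[P]_x (sqnorm (g x - t))%:E =
    \sum_i \int[P]_x ((g x i 0 - t i 0) ^+ 2)%:E)%E.
  rewrite -ge0_integral_sum//.
  - by apply: eq_integral => x _; rewrite sqnormE -sumEFin; apply: eq_bigr => i _; rewrite !mxE.
  - move=> i; apply/measurable_EFinP; apply: measurable_funX; exact: measurable_funB.
  - by move=> i x _; rewrite lee_fin sqr_ge0.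
rewrite sqnormE -sumEFin; apply: lee_sum => i _.
by rewrite !mxE; exact: sqr_mean_sub_le.
Qed.

End jensen.

(** Integrals of signed functions are differences of integrals of nonnegative
    ones, each of which depends measurably on the parameter by Tonelli. *)
Lemma measurable_meanvec d1 d2 (T1 : measurableType d1) (T2 : measurableType d2)
    (R : realType) (P : {sigma_finite_measure set T2 -> \bar R}) n
    (g : T1 * T2 -> 'cV[R]_n) : measurable_fun setT g ->
  measurable_fun setT (fun x => meanvec P (fun y => g (x, y))).
Proof.
move=> /measurable_fun_cVP mg; apply/measurable_fun_cVP => i.
rewrite (_ : (fun _ => _) = (fun x => fine
    (\int[P]_y (fun p => (g p i 0)%:E)^\+ (x, y) -
     \int[P]_y (fun p => (g p i 0)%:E)^\- (x, y))%E)).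
  apply: (measurableT_comp (fine_measurable measurableT)).
  have mi : measurable_fun setT (fun p => (g p i 0)%:E) by exact/measurable_EFinP.
  by apply: emeasurable_funB;
    apply: (measurable_fun_fubini_tonelli_F (_ : _ -> \bar R)) => //;
    [exact: measurable_funepos|exact: measurable_funeneg].
apply/funext => x; rewrite mxE /Rintegral; congr fine.
rewrite integralE; congr (_ - _)%E; apply: eq_integral => y _.
  by rewrite !funeposE.
by rewrite !funenegE.
Qed.

(** * The multivariate normal distribution *)

Section multinormal_theory.
Context {R : realType}.

(** Intersect an exhaustion by sets of finite Lebesgue measure with the sets where
    the density is at most k.  The instance below gives access to Tonelli for
    iterated integrals over normal laws. *)
Lemma multinormal_sigma_finite n (mu : 'cV[R]_n) (V : 'M[R]_n) :
  sigma_finite setT (multinormal mu V).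
Proof.
have /sigma_finiteP[F [TF ndF Foo]] := sigma_finiteT (@lebesgue_cV R n).
pose G k := [set x | multinormal_pdf mu V x <= k%:R].
have mG k : measurable (G k).
  rewrite (_ : G k = setT `&` multinormal_pdf mu V @^-1` [set` `]-oo, k%:R]]).
    exact: measurable_multinormal_pdf.
  by rewrite setTI; apply/seteqP; split=> x; rewrite /G /= in_itv.
exists (fun k => F k `&` G k).
  apply/seteqP; split=> // x _.
  have : setT x by []; rewrite TF => -[i _ Fix].
  pose N := Num.bound (multinormal_pdf mu V x).
  exists (maxn i N) => //; split.
    by move: (Fix); move: (x); exact/subsetPset/ndF/leq_maxl.
  rewrite /G /=; apply: le_trans (ltW (archi_boundP (multinormal_pdf_ge0 mu V x))) _.
  by rewrite ler_nat leq_maxr.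
move=> k; have [mF Fk] := Foo k; split; first exact: measurableI.
apply: (@le_lt_trans _ _ (\int[lebesgue_cV n]_(x in F k `&` G k) (k%:R)%:E)%E).
  apply: ge0_le_integral => //.
  - exact: measurableI.
  - by move=> x _; rewrite lee_fin multinormal_pdf_ge0.
  - apply/measurable_EFinP; apply: measurable_funTS.
    exact: measurable_multinormal_pdf.
  - by move=> x [_ Gx]; rewrite lee_fin.
rewrite integral_cst/=; last exact: measurableI.
rewrite lte_mul_pinfty ?lee_fin//.
apply: le_lt_trans Fk; apply: le_measure; rewrite ?inE//.
exact: measurableI.
Qed.

HB.instance Definition _ n (mu : 'cV[R]_n) (V : 'M[R]_n) :=
  @Measure_isSigmaFinite.Build _ _ _ (multinormal mu V)
    (multinormal_sigma_finite mu V).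

Lemma ge0_integral_multinormal n (mu : 'cV[R]_n) (V : 'M[R]_n)
    (f : 'cV[R]_n -> \bar R) :
  measurable_fun setT f -> (forall x, (0 <= f x)%E) ->
  (\int[multinormal mu V]_x f x =
   \int[lebesgue_cV n]_x (f x * (multinormal_pdf mu V x)%:E))%E.
Proof.
move=> mf f0; apply: ge0_integral_density => //.
- exact: measurable_multinormal_pdf.
- exact: multinormal_pdf_ge0.
Qed.

Lemma multinormal_pdf_affine n (M : 'M[R]_n) (c mu y : 'cV[R]_n) (V : 'M[R]_n) :
  M \in unitmx -> V \in unitmx ->
  multinormal_pdf mu V y =
  `|\det M| * multinormal_pdf (M *m mu + c) (M *m V *m M^T) (M *m y + c).
Proof.
move=> uM uV; rewrite /multinormal_pdf.
have -> : M *m y + c - (M *m mu + c) = M *m (y - mu).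
  by rewrite mulmxBr opprD addrACA subrr addr0.
have -> : invmx (M *m V *m M^T) = (invmx M)^T *m invmx V *m (invmx M)^T^T.
  have uP : M *m V *m M^T \in unitmx by rewrite !unitmx_mul uM uV unitmx_tr.
  apply: (can_inj (mulmxK uP)); rewrite mulVmx// trmxK !mulmxA.
  by rewrite mulmxKV// mulmxKV// -trmx_mul mulmxV// trmx1.
rewrite qform_congr trmxK mulmxA mulVmx// mul1mx mulrA; congr (_ * _).
have M0 : \det M != 0 by rewrite -unitfE -unitmxE.
have -> : (2 * pi) ^+ n * \det (M *m V *m M^T) =
    \det M ^+ 2 * ((2 * pi) ^+ n * \det V).
  by rewrite !det_mulmx det_tr; ring.
rewrite (sqrtrM _ (sqr_ge0 _)) sqrtr_sqr invfM mulrA mulfV ?mul1r//.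
by rewrite normr_eq0.
Qed.

Lemma ge0_integral_multinormal_affine n (M : 'M[R]_n) (c mu : 'cV[R]_n)
    (V : 'M[R]_n) (f : 'cV[R]_n -> \bar R) :
  M \in unitmx -> V \in unitmx ->
  measurable_fun setT f -> (forall x, (0 <= f x)%E) ->
  (\int[multinormal (M *m mu + c) (M *m V *m M^T)]_x f x =
   \int[multinormal mu V]_y f (M *m y + c)%R)%E.
Proof.
move=> uM uV mf f0.
have mfc : measurable_fun setT (fun y => f (M *m y + c)).
  apply: (measurableT_comp mf); apply: measurable_addmx => //.
  exact: measurable_mulmx.
pose g x := (f x * (multinormal_pdf (M *m mu + c) (M *m V *m M^T) x)%:E)%E.
have g0 x : (0 <= g x)%E by rewrite mule_ge0// lee_fin multinormal_pdf_ge0.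
have mg : measurable_fun setT g.
  apply: emeasurable_funM => //; apply/measurable_EFinP.
  exact: measurable_multinormal_pdf.
have mgc : measurable_fun setT (fun v : 'cV[R]_n => g (v + c)).
  by apply: (measurableT_comp mg); exact: measurable_addmx.
have mgM : measurable_fun setT (fun y => g (M *m y + c)).
  by apply: (measurableT_comp mgc); exact: measurable_mulmx.
have M0 : `|\det M| != 0 by rewrite normr_eq0 -unitfE -unitmxE.
apply: (etrans (ge0_integral_multinormal _ _ mf f0)).
apply: (etrans _ (esym (ge0_integral_multinormal mu V mfc (fun y => f0 _)))).
transitivity (\int[lebesgue_cV n]_y ((`|\det M|)%:E * g (M *m y + c)%R))%E; last first.
  apply: eq_integral => y _; rewrite (multinormal_pdf_affine c _ _ uM uV) /g.
  by rewrite EFinM muleCA.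
have i0 : (0 <= `|\det M|%:E)%E by rewrite lee_fin.
rewrite (ge0_integralZl _ measurableT mgM (fun y _ => g0 _) i0).
rewrite (ge0_integral_linear_change uM mgc (fun y => g0 _)) muleA -EFinM (divff M0).
by rewrite mul1e (ge0_integral_cV_translate c mg g0).
Qed.

Lemma multinormal_pdf_block m n (a x : 'cV[R]_m) (b y : 'cV[R]_n)
    (V1 : 'M[R]_m) (V2 : 'M[R]_n) :
  V1 \in unitmx -> V2 \in unitmx -> 0 <= \det V1 ->
  multinormal_pdf (col_mx a b) (block_mx V1 0 0 V2) (col_mx x y) =
  multinormal_pdf a V1 x * multinormal_pdf b V2 y.
Proof.
move=> u1 u2 d1; rewrite /multinormal_pdf.
have uB : block_mx V1 0 0 V2 \in unitmx.
  by rewrite unitmxE det_ublock unitrM -!unitmxE u1.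
rewrite invmx_block_diag// opp_col_mx add_col_mx.
have -> : qform (block_mx (invmx V1) 0 0 (invmx V2)) (col_mx (x - a) (y - b)) =
    qform (invmx V1) (x - a) + qform (invmx V2) (y - b).
  rewrite qformE mul_block_col !mul0mx addr0 add0r tr_col_mx mul_row_col mxE.
  by rewrite !qformE.
rewrite det_ublock exprD.
have -> : (2 * pi) ^+ m * (2 * pi) ^+ n * (\det V1 * \det V2) =
  ((2 * pi) ^+ m * \det V1) * ((2 * pi) ^+ n * \det V2) :> R by ring.
rewrite sqrtrM; last by rewrite mulr_ge0// exprn_ge0// mulr_ge0// pi_ge0.
rewrite invfM mulrACA -expRD; congr (_ * expR _); ring.
Qed.

Lemma ge0_integral_multinormal_block m n (a : 'cV[R]_m) (b : 'cV[R]_n)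
    (V1 : 'M[R]_m) (V2 : 'M[R]_n) (f : 'cV[R]_(m + n) -> \bar R) :
  V1 \in unitmx -> V2 \in unitmx -> 0 <= \det V1 ->
  measurable_fun setT f -> (forall x, (0 <= f x)%E) ->
  (\int[multinormal (col_mx a b) (block_mx V1 0 0 V2)]_z f z =
   \int[multinormal a V1]_x \int[multinormal b V2]_y f (col_mx x y))%E.
Proof.
move=> u1 u2 d1 mf f0.
have mpdf k mu V : measurable_fun setT (EFin \o @multinormal_pdf R k mu V).
  by apply/measurable_EFinP; exact: measurable_multinormal_pdf.
rewrite (ge0_integral_multinormal _ _ mf f0).
rewrite ge0_integral_lebesgue_col_mx; last 2 first.
- by apply: emeasurable_funM => //; exact: mpdf.
- by move=> v; apply: mule_ge0 => //=; rewrite lee_fin multinormal_pdf_ge0.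
rewrite ge0_integral_multinormal; last 2 first.
- apply: (measurable_fun_fubini_tonelli_F (fun p => f (col_mx p.1 p.2))) => //.
  by apply: (measurableT_comp mf); exact: measurable_col_mx_pair.
- by move=> x; exact: integral_ge0.
have mfx x : measurable_fun setT (fun y => f (col_mx x y)).
  by apply: (measurableT_comp mf); exact: measurable_col_mxr.
apply: eq_integral => x _.
rewrite (ge0_integral_multinormal _ _ (mfx x) (fun y => f0 _)) muleC.
rewrite -ge0_integralZl//.
- apply: eq_integral => y _; rewrite multinormal_pdf_block// EFinM.
  by rewrite muleCA.
- by apply: emeasurable_funM => //; exact: mpdf.
- by move=> y _; rewrite mule_ge0// lee_fin multinormal_pdf_ge0.
- by rewrite lee_fin multinormal_pdf_ge0.
Qed.

Lemma multinormal_setT1 (a : 'cV[R]_1) (V : 'M[R]_1) : posdefmx V ->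
  multinormal a V setT = 1%E.
Proof.
move=> pV.
have V0 : 0 < V 0 0.
  have [_ /(_ 1%:M)] := pV; rewrite -scalemx1 scale1r.
  rewrite /qform mulmx1 trmx1 mul1mx; apply.
  by apply/eqP => /colP/(_ 0)/eqP; rewrite !mxE oner_eq0.
rewrite /multinormal ge0_integral_cV_cons; last 2 first.
- by apply/measurable_EFinP; exact: measurable_multinormal_pdf.
- by move=> v; rewrite lee_fin multinormal_pdf_ge0.
rewrite -(integral_normal_pdf (a 0 0) (Num.sqrt (V 0 0))).
apply: eq_integral => x _; rewrite integral_dirac//=; last first.
  apply/measurable_EFinP.
  apply: (measurableT_comp (measurable_multinormal_pdf a V)).
  exact: measurable_cV_consr.
have : (cV_cons (x, 0) : 'cV[R]_1) 0 0 = x by exact: (cV_consE0 (n := 0)).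
move: (cV_cons (x, 0) : 'cV[R]_1) => y yx.
rewrite diracT mul1e normal_pdfE ?gt_eqF ?sqrtr_gt0//; congr EFin.
rewrite /multinormal_pdf /normal_peak /normal_fun sqr_sqrtr ?ltW//.
rewrite det_mx11 [V]mx11_scalar invmx_scalar !mxE mulr1n /qform.
congr (_ * expR _).
  by congr (Num.sqrt _)^-1; rewrite expr1 -mulr_natl; ring.
rewrite mul_mx_scalar -scalemxAl mxE mxE big_ord1 !mxE.
rewrite yx; field; exact: lt0r_neq0.
Qed.

(** Induction on the dimension: block elimination maps N(mu, V) to a product of
    a normal law on the line and one in dimension n. *)
Lemma multinormal_setT n (mu : 'cV[R]_n) (V : 'M[R]_n) : posdefmx V ->
  multinormal mu V setT = 1%E.
Proof.
elim: n mu V => [|n IHn] mu V pV.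
  rewrite /multinormal integral_dirac//=; last first.
    by apply/measurable_EFinP; exact: measurable_multinormal_pdf.
  rewrite diracT mul1e /multinormal_pdf /qform expr0 mul1r det_mx00 sqrtr1 invr1.
  by rewrite mul1r mxE big_ord0 oppr0 mul0r expR0.
have [uD TVT] := @posdefmx_elim _ 1 n V _ pV erefl.
set T := block_mx _ _ _ _ in TVT.
have uT : T \in unitmx by rewrite (@unitmxE _ (1 + n)) (@det_ublock _ 1) !det1 mulr1 unitr1.
have uV := posdefmx_unit pV.
have [pV1 pV2] : posdefmx (@ulsubmx _ 1 n 1 n V - @ursubmx _ 1 n 1 n V *m
        invmx (@drsubmx _ 1 n 1 n V) *m @dlsubmx _ 1 n 1 n V)
    /\ posdefmx (@drsubmx _ 1 n 1 n V).
  by apply: posdefmx_block; rewrite -TVT; exact: (@posdefmx_congr_unit _ (1 + n)).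
have -> : multinormal mu V setT = (\int[multinormal mu V]_x 1)%E.
  by rewrite integral_cst// mul1e.
rewrite -(@ge0_integral_multinormal_affine _ T 0 mu V (cst 1%E))// TVT addr0.
rewrite -[(T *m mu)%R](@vsubmxK _ 1 n).
rewrite (@ge0_integral_multinormal_block 1 n)//.
- rewrite (eq_integral (cst 1%E)) => [|x _].
    by rewrite integral_cst// mul1e; exact: multinormal_setT1.
  transitivity (1 * multinormal (@dsubmx _ 1 n _ (T *m mu))
    (@drsubmx _ 1 n 1 n V) setT)%E; last by rewrite mul1e; exact: IHn.
  exact: (integral_cst (multinormal _ _) measurableT 1%E).
- exact: posdefmx_unit.
- rewrite det_mx11.
  have [_ /(_ 1%:M)] := pV1; rewrite /qform mulmx1 trmx1 mul1mx => h.
  apply/ltW/h.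
  by apply/eqP => /colP/(_ 0)/eqP; rewrite !mxE oner_eq0.
Qed.

(** Otherwise the normalizing constant, hence the density, would vanish by the
    convention on square roots of nonpositive numbers, against total mass one. *)
Lemma posdefmx_det_gt0 n (V : 'M[R]_n) : posdefmx V -> 0 < \det V.
Proof.
move=> pV; rewrite ltNge; apply/negP => d0.
have := multinormal_setT 0 pV; rewrite /multinormal integral0_eq => [/eqP|x _].
  by rewrite eq_sym onee_eq0.
rewrite /multinormal_pdf ler0_sqrtr ?invr0 ?mul0r//.
by rewrite mulr_ge0_le0// exprn_ge0// mulr_ge0// pi_ge0.
Qed.

Lemma multinormal_pdf_gt0 n (mu x : 'cV[R]_n) (V : 'M[R]_n) :
  posdefmx V -> 0 < multinormal_pdf mu V x.
Proof.
move=> /posdefmx_det_gt0 d0; rewrite mulr_gt0 ?expR_gt0// invr_gt0 sqrtr_gt0.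
by rewrite mulr_gt0// exprn_gt0// mulr_gt0// pi_gt0.
Qed.

End multinormal_theory.

(** * Lower bound for the minimax risk of a normal mean *)

Section minimax_bound.
Context {R : realType}.

Lemma sqnormZ n (c : R) (v : 'cV[R]_n) : sqnorm (c *: v) = c ^+ 2 * sqnorm v.
Proof.
by rewrite !sqnormE mulr_sumr; apply: eq_bigr => i _; rewrite mxE exprMn.
Qed.

Lemma sqnorm_parallelogram n (u v : 'cV[R]_n) :
  sqnorm (u - v) + sqnorm (u + v) = 2 * sqnorm u + 2 * sqnorm v.
Proof.
rewrite !sqnormE !mulr_sumr -!big_split; apply: eq_bigr => i _ /=.
by rewrite !mxE; ring.
Qed.

Section changes.
Local Open Scope ereal_scope.
Variables (n : nat) (V : 'M[R]_n) (f : 'cV[R]_n -> \bar R).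
Hypotheses (uV : V \in unitmx) (mf : measurable_fun setT f) (f0 : forall x, 0 <= f x).

Lemma ge0_integral_multinormal_shift (a : 'cV[R]_n) :
  \int[multinormal a V]_x f x = \int[multinormal 0 V]_x f (x + a)%R.
Proof.
have := ge0_integral_multinormal_affine a 0 (unitmx1 _ _) uV mf f0.
rewrite mulmx0 add0r mul1mx trmx1 mulmx1 => e; apply: (etrans e).
by apply: eq_integral => x _; rewrite mul1mx.
Qed.

Lemma ge0_integral_multinormal_sym :
  \int[multinormal 0 V]_x f (- x)%R = \int[multinormal 0 V]_x f x.
Proof.
have u1 : (- (1%:M : 'M[R]_n))%R \in unitmx by rewrite -scaleN1r unitmxZ ?unitmx1// unitrN1.
have := ge0_integral_multinormal_affine 0 0 u1 uV mf f0.
rewrite mulmx0 addr0 linearN/= trmx1 mulmxN mulmx1 mulNmx mul1mx opprK => e.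
apply: (etrans _ (esym e)).
by apply: eq_integral => x _; rewrite mulNmx mul1mx addr0.
Qed.

Lemma ge0_integral_multinormal_scale (c : R) : (0 < c)%R ->
  \int[multinormal 0 (c *: V)]_x f x = \int[multinormal 0 V]_x f (Num.sqrt c *: x)%R.
Proof.
move=> c0.
have u1 : ((Num.sqrt c)%:M : 'M[R]_n) \in unitmx.
  by rewrite unitmxE det_scalar unitfE expf_neq0// lt0r_neq0// sqrtr_gt0.
have := ge0_integral_multinormal_affine 0 0 u1 uV mf f0.
rewrite mulmx0 addr0 tr_scalar_mx mul_mx_scalar mul_scalar_mx scalerA.
rewrite -expr2 (sqr_sqrtr (ltW c0)) => e; apply: (etrans e).
by apply: eq_integral => x _; rewrite mul_scalar_mx addr0.
Qed.

End changes.

Lemma measurable_multinormal_pdf2 d (T : measurableType d) n (V : 'M[R]_n)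
    (f g : T -> 'cV[R]_n) :
  measurable_fun setT f -> measurable_fun setT g ->
  measurable_fun setT (fun t => multinormal_pdf (f t) V (g t)).
Proof.
move=> mf mg; apply: measurable_funM => //; apply: measurableT_comp => //.
apply: measurable_funM => //; apply: measurableT_comp => //.
by apply: measurable_qform; exact: measurable_submx.
Qed.

(** The trace of [V], which is the constant risk of the identity estimator; the
    integral form makes its scaling in [V] a change of variables. *)
Definition mean_sqnorm n (V : 'M[R]_n) : \bar R :=
  (\int[multinormal 0 V]_x (sqnorm x)%:E)%E.

Lemma mean_sqnorm_scale n (c : R) (V : 'M[R]_n) : 0 < c -> V \in unitmx ->
  mean_sqnorm (c *: V) = (c%:E * mean_sqnorm V)%E.
Proof.
move=> c0 uV; have ms : measurable_fun setT (fun x : 'cV[R]_n => (sqnorm x)%:E).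
  exact: measurable_sqnormE.
have s0 (x : 'cV[R]_n) : (0 <= (sqnorm x)%:E)%E by rewrite lee_fin sqnorm_ge0.
apply: (etrans (ge0_integral_multinormal_scale uV ms s0 c0)).
under eq_integral do rewrite sqnormZ (sqr_sqrtr (ltW c0)) EFinM.
by rewrite ge0_integralZl// lee_fin ltW.
Qed.

Lemma risk_star_id n (V : 'M[R]_n) (xi : 'cV[R]_n) : V \in unitmx ->
  risk_star V xi id = mean_sqnorm V.
Proof.
move=> uV; have ms : measurable_fun setT (fun x : 'cV[R]_n => (sqnorm (x - xi))%:E).
  by apply: measurable_sqnormE; exact: measurable_submx.
have s0 (x : 'cV[R]_n) : (0 <= (sqnorm (x - xi))%:E)%E.
  by rewrite lee_fin sqnorm_ge0.
apply: (etrans (ge0_integral_multinormal_shift uV ms s0 _)).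
by apply: eq_integral => x _; rewrite addrK.
Qed.

(** The law is symmetric about its mean a, so the integral is unchanged when
    x - a is replaced by its opposite.  Add both forms and use the parallelogram
    law: twice the integral is at least twice [mean_sqnorm V]. *)
Lemma mean_sqnorm_le n (V : 'M[R]_n) (a e : 'cV[R]_n) : V \in unitmx ->
  (mean_sqnorm V <= \int[multinormal a V]_x (sqnorm (e - x))%:E)%E.
Proof.
move=> uV.
have ms b : measurable_fun setT (fun x : 'cV[R]_n => (sqnorm (b - x))%:E).
  by apply: measurable_sqnormE; exact: measurable_submx.
have ms' b : measurable_fun setT (fun x : 'cV[R]_n => (sqnorm (b + x))%:E).
  by apply: measurable_sqnormE; exact: measurable_addmx.
have s0 (v : 'cV[R]_n) : (0 <= (sqnorm v)%:E)%E by rewrite lee_fin sqnorm_ge0.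
rewrite (ge0_integral_multinormal_shift uV (ms e) (fun x => s0 _)).
have -> : (\int[multinormal 0 V]_x (sqnorm (e - (x + a)))%:E =
    \int[multinormal 0 V]_x (sqnorm (e - a - x))%:E)%E.
  by apply: eq_integral => x _; rewrite [(x + a)%R]addrC opprD addrA.
move: (e - a) => b; rewrite -(@lee_pmul2l _ 2%:E)//.
have -> : (2%:E * \int[multinormal 0 V]_x (sqnorm (b - x))%:E =
    \int[multinormal 0 V]_x (sqnorm (b - x) + sqnorm (b + x))%:E)%E.
  under [RHS]eq_integral do rewrite EFinD.
  rewrite ge0_integralD//.
  rewrite -(ge0_integral_multinormal_sym uV (ms' b) (fun x => s0 _)).
  by rewrite mule_natl mule2n.
rewrite -[leLHS]ge0_integralZl//; last exact: measurable_sqnormE.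
apply: ge0_le_integral => //.
- by move=> x _; rewrite mule_ge0.
- by apply: emeasurable_funM => //; exact: measurable_sqnormE.
- by under eq_fun do rewrite EFinD; exact: emeasurable_funD.
- move=> x _; rewrite -EFinM lee_fin sqnorm_parallelogram lerDr.
  by rewrite mulr_ge0// sqnorm_ge0.
Qed.

Lemma qform_sub n (P : 'M[R]_n) (u v : 'cV[R]_n) (c : R) : P^T = P ->
  qform P (u - c *: v) = qform P u - 2 * c * (u^T *m P *m v) 0 0 + c ^+ 2 * qform P v.
Proof.
move=> sP; have e : (u - c *: v)^T = u^T - c *: v^T by rewrite linearB/= linearZ.
rewrite /qform e !mulmxBl !mulmxBr -!scalemxAl -!scalemxAr.
have -> : v^T *m P *m u = u^T *m P *m v.
  rewrite [LHS]mx11_scalar -tr_scalar_mx -mx11_scalar.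
  by rewrite !trmx_mul trmxK sP mulmxA.
move: (_ *m u) (u^T *m P *m v) (_ *m v) => a b d.
by rewrite !mxE; ring.
Qed.

(** Likelihood times prior is marginal times posterior for the prior
    N(0, tau V), tau = c / (1 - c): the marginal is N(0, (1 + tau) V) and the
    posterior N(c z, c V).  A prior covariance proportional to [V] keeps the
    whole computation scalar. *)
Lemma multinormal_pdf_bayes n (V : 'M[R]_n) (c : R) (xi z : 'cV[R]_n) :
  posdefmx V -> 0 < c < 1 ->
  multinormal_pdf xi V z * multinormal_pdf 0 ((c / (1 - c)) *: V) xi =
  multinormal_pdf 0 ((1 - c)^-1 *: V) z * multinormal_pdf (c *: z) (c *: V) xi.
Proof.
move=> pV /andP[c0 c1].
have c1' : 0 < 1 - c by rewrite subr_gt0.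
have uV := posdefmx_unit pV.
have d0 := posdefmx_det_gt0 pV.
have uZ a : 0 < a -> a *: V \in unitmx by move=> a0; apply/posdefmx_unit/posdefmx_scale.
rewrite /multinormal_pdf !subr0 !invmxZ ?uZ ?invr_gt0 ?divr_gt0// !detZ.
have pi0 : 0 < (2 * pi : R) ^+ n by rewrite exprn_gt0// mulr_gt0// pi_gt0.
rewrite [LHS]mulrACA [RHS]mulrACA -!expRD -!invfM -!sqrtrM; last 2 first.
- by rewrite ltW// !mulr_gt0// exprn_gt0// invr_gt0.
- by rewrite ltW// mulr_gt0.
congr ((Num.sqrt _)^-1 * expR _).
  by rewrite [(c / _) ^+ n]exprMn; ring.
have sP : (invmx V)^T = invmx V by rewrite trmx_inv; case: pV => ->.
have qZ a v : qform (a *: invmx V) v = a * qform (invmx V) v.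
  by rewrite /qform -scalemxAr -scalemxAl mxE.
rewrite !qZ -[xi in z - xi]scale1r !qform_sub//.
have -> : xi^T *m invmx V *m z = z^T *m invmx V *m xi.
  rewrite [LHS]mx11_scalar -tr_scalar_mx -mx11_scalar.
  by rewrite !trmx_mul trmxK sP mulmxA.
by field; rewrite !lt0r_neq0.
Qed.

End minimax_bound.

Section minimax_lower.
Context {R : realType}.

Lemma multinormal_cst n (a : 'cV[R]_n) (V : 'M[R]_n) (r : \bar R) :
  posdefmx V -> (\int[multinormal a V]_x (cst r) x = r)%E.
Proof.
move=> pV; apply: (etrans (integral_cst (multinormal a V) measurableT r)).
by apply: (etrans (congr1 _ (multinormal_setT a pV))); rewrite mule1.
Qed.

(** Bayes risk under the prior N(0, tau V): it is at most M, and after exchanging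
    the integrals it is an average of posterior risks, each of which is at least
    [mean_sqnorm (c *: V)]. *)
Lemma scaled_mean_sqnorm_le n (V : 'M[R]_n) (delta : 'cV[R]_n -> 'cV[R]_n)
    (c : R) (M : \bar R) :
  posdefmx V -> measurable_fun setT delta -> 0 < c < 1 ->
  (forall xi, risk_star V xi delta <= M)%E ->
  (c%:E * mean_sqnorm V <= M)%E.
Proof.
move=> pV md c01 RM; have /andP[c0 c1] := c01.
have c1' : 0 < 1 - c by rewrite subr_gt0.
have uV := posdefmx_unit pV.
set W : 'M[R]_n := (c / (1 - c)) *: V; set Y : 'M[R]_n := (1 - c)^-1 *: V.
have pW : posdefmx W by apply: posdefmx_scale; rewrite ?divr_gt0.
have pY : posdefmx Y by apply: posdefmx_scale; rewrite ?invr_gt0.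
pose s (xi z : 'cV[R]_n) := (sqnorm (delta z - xi))%:E.
have s0 xi z : (0 <= s xi z)%E by rewrite lee_fin sqnorm_ge0.
have ms xi : measurable_fun setT (s xi).
  by apply: measurable_sqnormE; exact: measurable_submx.
have ms' z : measurable_fun setT (s ^~ z).
  by apply: measurable_sqnormE; exact: measurable_submx.
have ms2 : measurable_fun setT (fun p : 'cV[R]_n * 'cV[R]_n => s p.1 p.2).
  by apply: measurable_sqnormE; apply: measurable_submx => //; exact: (measurableT_comp md).
pose l (xi z : 'cV[R]_n) := multinormal_pdf xi V z.
pose w (xi : 'cV[R]_n) := multinormal_pdf 0 W xi.
pose y (z : 'cV[R]_n) := multinormal_pdf 0 Y z.
pose q (z xi : 'cV[R]_n) := multinormal_pdf (c *: z) (c *: V) xi.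
have ml : measurable_fun setT (fun p : 'cV[R]_n * 'cV[R]_n => (l p.1 p.2)%:E).
  by apply/measurable_EFinP; exact: measurable_multinormal_pdf2.
have mw : measurable_fun setT (fun p : 'cV[R]_n * 'cV[R]_n => (w p.1)%:E).
  by apply/measurable_EFinP; exact: measurable_multinormal_pdf2.
have mscale : measurable_fun setT (fun z : 'cV[R]_n => c *: z).
  have mid : measurable_fun setT (@id 'cV[R]_n) by exact: measurable_id.
  have := measurable_mulmx c%:M mid.
  by apply: eq_measurable_fun => z _; rewrite mul_scalar_mx.
have mq : measurable_fun setT (fun p : 'cV[R]_n * 'cV[R]_n => (q p.1 p.2)%:E).
  apply/measurable_EFinP; apply: measurable_multinormal_pdf2 => //.
  exact: (measurableT_comp mscale).
have l0 xi z : (0 <= (l xi z)%:E)%E by rewrite lee_fin multinormal_pdf_ge0.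
have w0 xi : (0 <= (w xi)%:E)%E by rewrite lee_fin multinormal_pdf_ge0.
have y0 z : (0 <= (y z)%:E)%E by rewrite lee_fin multinormal_pdf_ge0.
have q0 z xi : (0 <= (q z xi)%:E)%E by rewrite lee_fin multinormal_pdf_ge0.
pose I z := (\int[lebesgue_cV n]_xi (s xi z * (q z xi)%:E))%E.
have mI : measurable_fun setT I.
  apply: (measurable_fun_fubini_tonelli_F (fun p => s p.2 p.1 * (q p.1 p.2)%:E)%E).
    apply: emeasurable_funM => //.
    by apply: measurable_sqnormE; apply: measurable_submx => //; exact: (measurableT_comp md).
  by move=> p; rewrite mule_ge0.
have I0 z : (0 <= I z)%E by apply: integral_ge0 => xi _; rewrite mule_ge0.
have leI z : (c%:E * mean_sqnorm V <= I z)%E.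
  rewrite -mean_sqnorm_scale//.
  have ucV : c *: V \in unitmx by exact/posdefmx_unit/posdefmx_scale.
  apply: (le_trans (mean_sqnorm_le (c *: z) (delta z) ucV)).
  by rewrite (ge0_integral_multinormal _ _ (ms' z) (fun xi => s0 xi z)).
have step1 : (c%:E * mean_sqnorm V <= \int[multinormal 0 Y]_z I z)%E.
  rewrite -[leLHS](multinormal_cst 0 _ pY).
  apply: ge0_le_integral => //.
  move=> x _; rewrite mule_ge0 ?lee_fin ?(ltW c0)// integral_ge0// => v _.
  by rewrite lee_fin sqnorm_ge0.
pose h p := (s p.1 p.2 * ((l p.1 p.2)%:E * (w p.1)%:E))%E.
have mh : measurable_fun setT h.
  by apply: emeasurable_funM; [exact: ms2|apply: emeasurable_funM; [exact: ml|exact: mw]].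
have h0 p : (0 <= h p)%E by rewrite mule_ge0// mule_ge0.
pose J xi := (\int[lebesgue_cV n]_z (s xi z * (l xi z)%:E))%E.
have mJ : measurable_fun setT J.
  apply: (measurable_fun_fubini_tonelli_F (fun p => s p.1 p.2 * (l p.1 p.2)%:E)%E).
    by apply: emeasurable_funM; [exact: ms2|exact: ml].
  by move=> p; rewrite mule_ge0.
have J0 xi : (0 <= J xi)%E by apply: integral_ge0 => z _; rewrite mule_ge0.
have JM xi : (J xi <= M)%E.
  apply: le_trans (RM xi).
  by rewrite /risk_star (ge0_integral_multinormal _ _ (ms xi) (s0 xi)).
have swap : (\int[multinormal 0 Y]_z I z = \int[multinormal 0 W]_xi J xi)%E.
  apply: (etrans (ge0_integral_multinormal _ _ mI I0)).
  apply: (etrans _ (esym (ge0_integral_multinormal _ _ mJ J0))).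
  transitivity (\int[lebesgue_cV n]_z \int[lebesgue_cV n]_xi h (xi, z))%E.
    apply: eq_integral => z _; rewrite -ge0_integralZr//.
    - apply: eq_integral => xi _; rewrite /h /= -!muleA; congr (_ * _)%E.
      by rewrite -!EFinM mulrC -multinormal_pdf_bayes.
    - apply: emeasurable_funM; first exact: ms'.
      by apply/measurable_EFinP; exact: measurable_multinormal_pdf.
    - by move=> xi _; rewrite mule_ge0.
  rewrite -(fubini_tonelli h)//; apply: eq_integral => xi _.
  rewrite -ge0_integralZr//.
  - by apply: eq_integral => z _; rewrite /h /= muleA.
  - apply: emeasurable_funM; first exact: ms.
    by apply/measurable_EFinP; exact: measurable_multinormal_pdf.
  - by move=> z _; rewrite mule_ge0.
apply: (le_trans step1); rewrite swap -[leRHS](multinormal_cst 0 M pW).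
apply: ge0_le_integral.
- exact: measurableT.
- by move=> xi _; exact: J0.
- exact: mJ.
- exact: measurable_cst.
- by move=> xi _; exact: JM.
Qed.

(** Let c tend to 1 in the previous bound. *)
Lemma mean_sqnorm_le_sup_risk n (V : 'M[R]_n) (delta : 'cV[R]_n -> 'cV[R]_n)
    (M : \bar R) :
  posdefmx V -> measurable_fun setT delta ->
  (forall xi, risk_star V xi delta <= M)%E -> (mean_sqnorm V <= M)%E.
Proof.
move=> pV md RM; apply/lee_mul01Pr.
  by apply: integral_ge0 => x _; rewrite lee_fin sqnorm_ge0.
by move=> c c01; exact: scaled_mean_sqnorm_le RM.
Qed.

End minimax_lower.

(** * Risks and the class of estimators with finite second moments *)

Section gamma.
Context {R : realType}.

Lemma sqnorm_mulmx_le m n (M : 'M[R]_(m, n)) :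
  exists2 C : R, 0 <= C & forall v, sqnorm (M *m v) <= C * sqnorm v.
Proof.
exists (\sum_i (\sum_j `|M i j|) ^+ 2) => [|v].
  by apply: sumr_ge0 => i _; rewrite sqr_ge0.
have vle j : `|v j 0| <= Num.sqrt (sqnorm v).
  rewrite -sqrtr_sqr ler_wsqrtr// sqnormE (bigD1 j)//= lerDl.
  by apply: sumr_ge0 => i _; rewrite sqr_ge0.
rewrite [leLHS]sqnormE mulr_suml; apply: ler_sum => i _.
rewrite -[X in _ * X](sqr_sqrtr (sqnorm_ge0 v)) -exprMn.
rewrite -[leLHS]real_normK ?num_real// lerXn2r ?nnegrE//.
  by rewrite mulr_ge0 ?sqrtr_ge0// sumr_ge0.
rewrite mxE mulr_suml; apply: (le_trans (ler_norm_sum _ _ _)).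
by apply: ler_sum => j _; rewrite normrM ler_wpM2l.
Qed.

Lemma sqnormD_le n (u v : 'cV[R]_n) : sqnorm (u + v) <= 2 * sqnorm u + 2 * sqnorm v.
Proof. by rewrite -sqnorm_parallelogram lerDr sqnorm_ge0. Qed.

Lemma sqnorm_integralZD_lty d (T : measurableType d) (P : {measure set T -> \bar R})
    m n (f : T -> 'cV[R]_n) (M : 'M[R]_(m, n)) (b : 'cV[R]_m) :
  (P setT < +oo)%E -> measurable_fun setT f ->
  (\int[P]_x (sqnorm (f x))%:E < +oo)%E ->
  (\int[P]_x (sqnorm (M *m f x + b))%:E < +oo)%E.
Proof.
move=> Poo mf foo; have [C C0 MC] := sqnorm_mulmx_le M.
have s0 k (v : 'cV[R]_k) : (0 <= (sqnorm v)%:E)%E by rewrite lee_fin sqnorm_ge0.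
apply: (@le_lt_trans _ _ (\int[P]_x ((2 * C)%:E * (sqnorm (f x))%:E + (2 * sqnorm b)%:E))%E).
  apply: ge0_le_integral => //.
  - apply: measurable_sqnormE; apply: measurable_addmx => //; exact: measurable_mulmx.
  - by apply: emeasurable_funD => //; apply: emeasurable_funM => //; exact: measurable_sqnormE.
  - move=> x _; rewrite -EFinM -EFinD lee_fin.
    apply: le_trans (sqnormD_le _ _) _.
    by rewrite lerD2r -mulrA ler_pM2l.
rewrite ge0_integralD//.
- rewrite ge0_integralZl//; [|exact: measurable_sqnormE|by rewrite lee_fin mulr_ge0].
  rewrite integral_cst// lte_add_pinfty//.
    by rewrite lte_mul_pinfty// lee_fin mulr_ge0.
  by rewrite lte_mul_pinfty// lee_fin mulr_ge0// sqnorm_ge0.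
- by move=> x _; rewrite mule_ge0// lee_fin mulr_ge0.
- by apply: emeasurable_funM => //; exact: measurable_sqnormE.
- by move=> x _; rewrite lee_fin mulr_ge0// sqnorm_ge0.
Qed.

Lemma multinormal_lty n (mu : 'cV[R]_n) (V : 'M[R]_n) : posdefmx V ->
  (multinormal mu V setT < +oo)%E.
Proof. by move=> pV; rewrite multinormal_setT// ltry. Qed.

Lemma Gamma_affine n (V : 'M[R]_n) (delta : 'cV[R]_n -> 'cV[R]_n)
    (M : 'M[R]_n) (b : 'cV[R]_n) : posdefmx V ->
  Gamma V delta -> Gamma V (fun y => M *m delta y + b).
Proof.
move=> pV [md doo]; split=> [|mu].
  by apply: measurable_addmx => //; exact: measurable_mulmx.
apply: sqnorm_integralZD_lty; [exact: multinormal_lty|exact: md|exact: doo].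
Qed.

Lemma GammaD n (V : 'M[R]_n) (d1 d2 : 'cV[R]_n -> 'cV[R]_n) :
  Gamma V d1 -> Gamma V d2 -> Gamma V (fun y => d1 y + d2 y).
Proof.
move=> [m1 f1] [m2 f2]; split=> [|mu]; first exact: measurable_addmx.
have s0 (v : 'cV[R]_n) : (0 <= (sqnorm v)%:E)%E by rewrite lee_fin sqnorm_ge0.
apply: (@le_lt_trans _ _ (\int[multinormal mu V]_x
    (2%:E * (sqnorm (d1 x))%:E + 2%:E * (sqnorm (d2 x))%:E))%E).
  apply: ge0_le_integral => //.
  - by apply: measurable_sqnormE; exact: measurable_addmx.
  - by apply: emeasurable_funD; apply: emeasurable_funM => //; exact: measurable_sqnormE.
  - by move=> x _; rewrite -!EFinM -EFinD lee_fin sqnormD_le.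
rewrite ge0_integralD//.
- rewrite !ge0_integralZl//; try exact: measurable_sqnormE.
  by apply: lte_add_pinfty; apply: lte_mul_pinfty => //; rewrite ?f1 ?f2.
- by move=> x _; rewrite mule_ge0.
- by apply: emeasurable_funM => //; exact: measurable_sqnormE.
- by move=> x _; rewrite mule_ge0.
- by apply: emeasurable_funM => //; exact: measurable_sqnormE.
Qed.

Lemma risk_sqnorm n (A V : 'M[R]_n) (mu : 'cV[R]_n) delta :
  risk (A^T *m A) V mu delta =
  (\int[multinormal mu V]_y (sqnorm (A *m (delta y - mu)))%:E)%E.
Proof. by apply: eq_integral => y _; rewrite qform_sqnorm. Qed.

Lemma risk_lty n (A V : 'M[R]_n) (mu : 'cV[R]_n) delta : posdefmx V ->
  Gamma V delta -> (risk (A^T *m A) V mu delta < +oo)%E.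
Proof.
move=> pV [md doo]; rewrite risk_sqnorm.
under eq_integral do rewrite mulmxBr -mulmxN.
apply: sqnorm_integralZD_lty; [exact: multinormal_lty|exact: md|exact: doo].
Qed.

(** A normal density is positive everywhere, so that a vanishing distance under
    one mean forces A d1 = A d2 Lebesgue almost everywhere, hence equal risks
    under every other mean. *)
Lemma eq_risk_of_dist0 n (A V : 'M[R]_n) (mu0 : 'cV[R]_n)
    (d1 d2 : 'cV[R]_n -> 'cV[R]_n) :
  posdefmx V -> measurable_fun setT d1 -> measurable_fun setT d2 ->
  (\int[multinormal mu0 V]_y (sqnorm (A *m (d1 y - d2 y)))%:E = 0)%E ->
  forall mu, risk (A^T *m A) V mu d1 = risk (A^T *m A) V mu d2.
Proof.
move=> pV m1 m2 d0 mu.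
have s0 (v : 'cV[R]_n) : (0 <= (sqnorm v)%:E)%E by rewrite lee_fin sqnorm_ge0.
have ms (f : 'cV[R]_n -> 'cV[R]_n) : measurable_fun setT f ->
    measurable_fun setT (fun y => (sqnorm (A *m f y))%:E).
  by move=> mf; apply: measurable_sqnormE; exact: measurable_mulmx.
have mpdf (nu : 'cV[R]_n) : measurable_fun setT (fun y => (multinormal_pdf nu V y)%:E).
  by apply/measurable_EFinP; exact: measurable_multinormal_pdf.
have pdf0 nu y : (0 <= (multinormal_pdf nu V y)%:E)%E.
  by rewrite lee_fin multinormal_pdf_ge0.
have md : measurable_fun setT (fun y => d1 y - d2 y) by exact: measurable_submx.
have mdm (f : 'cV[R]_n -> 'cV[R]_n) :
    measurable_fun setT f -> measurable_fun setT (fun y => f y - mu).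
  by move=> mf; exact: measurable_submx.
move: d0; rewrite (ge0_integral_multinormal _ _ (ms _ md) (fun y => s0 _)) => d0.
have ae0 : ae_eq (lebesgue_cV n) setT
    (fun y => (sqnorm (A *m (d1 y - d2 y)))%:E *
      (multinormal_pdf mu0 V y)%:E)%E (cst 0%E).
  apply/ae_eq_integral_abs => //; first by apply: emeasurable_funM; [exact: ms|exact: mpdf].
  by rewrite -[RHS]d0; apply: eq_integral => y _; rewrite gee0_abs// mule_ge0.
rewrite !risk_sqnorm.
apply: (etrans (ge0_integral_multinormal _ _ (ms _ (mdm _ m1)) (fun y => s0 _))).
apply: (etrans _ (esym (ge0_integral_multinormal _ _ (ms _ (mdm _ m2)) (fun y => s0 _)))).
apply: ge0_ae_eq_integral.
- exact: measurableT.
- by apply: emeasurable_funM; [exact: (ms _ (mdm _ m1))|exact: mpdf].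
- by apply: emeasurable_funM; [exact: (ms _ (mdm _ m2))|exact: mpdf].
- by move=> y _; rewrite mule_ge0.
- by move=> y _; rewrite mule_ge0.
apply: filterS ae0 => y /(_ I)/eqP e0 _.
move: e0; rewrite -EFinM eqe mulf_eq0 (gt_eqF (multinormal_pdf_gt0 _ _ pV)) orbF.
rewrite sqnorm_eq0 mulmxBr subr_eq0 => /eqP e.
by rewrite !mulmxBr e.
Qed.

End gamma.

(** Since [e] itself belongs to the class, minimaxity only asks that its supremum
    risk be a lower bound. *)
Lemma minimax_le (R : realType) (P E : Type) (Theta : set P) (C : set E)
    (r : P -> E -> \bar R) (e : E) : C e ->
  (forall e', C e' -> (sup_risk Theta r e <= sup_risk Theta r e')%E) ->
  minimax Theta C r e.
Proof.
move=> Ce le; split=> //; apply/eqP; rewrite eq_le; apply/andP; split.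
  by apply: le_ereal_inf_tmp => _ [e' Ce' <-]; exact: le.
by apply: ereal_inf_lbound; exists e.
Qed.

(** * Generalized Bayes estimators *)

Section sigma_finite_prior.
Context d (T : measurableType d) (R : realType).

(** The sets where f >= 1 / (n + 1) exhaust the space and have finite measure by
    Markov. *)
Lemma sigma_finite_of_integrable_gt0 (mu : {measure set T -> \bar R}) (f : T -> R) :
  measurable_fun setT f -> (forall x, 0 < f x) ->
  (\int[mu]_x (f x)%:E < +oo)%E -> sigma_finite setT mu.
Proof.
move=> mf f0 foo; have mf' : measurable_fun setT (EFin \o f) by exact/measurable_EFinP.
exists (fun n => setT `&` [set x | (n.+1%:R^-1%:E <= `|(f x)%:E|)%E]).
  apply/seteqP; split=> // x _; have [k] := ltr_add_invr (f0 x).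
  rewrite add0r => kf; exists k => //; split=> //=.
  by rewrite lee_fin gtr0_norm// ltW.
move=> n; have n0 : 0 < n.+1%:R^-1 :> R by rewrite invr_gt0.
split.
  by apply: emeasurable_fun_c_infty => //; exact: measurableT_comp.
have := le_integral_abse mu measurableT mf' n0.
have -> : (\int[mu]_x `|(EFin \o f) x| = \int[mu]_x (f x)%:E)%E.
  by apply: eq_integral => x _; rewrite gee0_abs// lee_fin ltW.
move=> /le_lt_trans/(_ foo); set X := mu _; case: X => [r _| |//]; first exact: ltry.
by rewrite gt0_muley ?lte_fin// ltxx.
Qed.

(** A copy of [mu] that carries its sigma-finiteness, so that Tonelli can be
    applied to a prior for which it is only a consequence of other hypotheses. *)
Definition with_sigma_finite (mu : {measure set T -> \bar R})
  (sf : sigma_finite setT mu) : set T -> \bar R := mu.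

HB.instance Definition _ (mu : {measure set T -> \bar R})
    (sf : sigma_finite setT mu) :=
  isMeasure.Build _ _ _ (with_sigma_finite sf)
    (@measure0 _ _ _ mu) (@measure_ge0 _ _ _ mu)
    (@measure_semi_sigma_additive _ _ _ mu).

HB.instance Definition _ (mu : {measure set T -> \bar R})
    (sf : sigma_finite setT mu) :=
  @Measure_isSigmaFinite.Build _ _ _ (with_sigma_finite sf) sf.

End sigma_finite_prior.

Section generalized_Bayes_theory.
Context {R : realType}.

(** The prior is sigma-finite because it integrates a positive likelihood; the
    posterior mean is then a quotient of two measurable parametric integrals. *)
Lemma measurable_generalized_Bayes p (prior : {measure set 'cV[R]_p -> \bar R})
    (V : 'M[R]_p) (delta : 'cV[R]_p -> 'cV[R]_p) : posdefmx V ->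
  generalized_Bayes prior id V delta -> measurable_fun setT delta.
Proof.
move=> pV GB.
have sf : sigma_finite setT prior.
  have [/andP[_ foo] _ _] := GB 0.
  apply: sigma_finite_of_integrable_gt0 foo.
    exact: measurable_multinormal_pdf2.
  by move=> x; exact: multinormal_pdf_gt0.
pose prior' : {sigma_finite_measure set 'cV[R]_p -> \bar R} := with_sigma_finite sf.
have ppE : prior = prior' by exact: eq_measure.
pose lik (q : 'cV[R]_p * 'cV[R]_p) := multinormal_pdf q.2 V q.1.
have mlik : measurable_fun setT lik by exact: measurable_multinormal_pdf2.
pose g1 (q : 'cV[R]_p * 'cV[R]_p) : 'cV[R]_p := \col_i (q.2 i 0 * lik q).
pose g2 (q : 'cV[R]_p * 'cV[R]_p) : 'cV[R]_1 := \col_i lik q.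
have mg1 : measurable_fun setT g1.
  apply/measurable_fun_cVP => i; under eq_fun do rewrite mxE.
  apply: measurable_funM => //.
  exact: (measurableT_comp (measurable_coor i) measurable_snd).
have mg2 : measurable_fun setT g2.
  by apply/measurable_fun_cVP => i; under eq_fun do rewrite mxE.
have mn1 := measurable_meanvec prior' mg1.
have mn2 := measurable_meanvec prior' mg2.
apply/measurable_fun_cVP => i.
rewrite (_ : (fun x => _) = (fun x =>
    meanvec prior' (fun t => g1 (x, t)) i 0 *
    (meanvec prior' (fun t => g2 (x, t)) 0 0) `^ (-1))).
  apply: measurable_funM; first exact: (measurableT_comp (measurable_coor i) mn1).
  apply: (measurableT_comp (measurable_powR _)).
  exact: (measurableT_comp (measurable_coor 0) mn2).
apply/funext => x; have [_ _ ->] := GB x.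
rewrite /meanvec !mxE -ppE powR_inv1; last first.
  by apply: Rintegral_ge0 => t _; rewrite mxE multinormal_pdf_ge0.
congr (_ / _); apply: eq_Rintegral => t _; by rewrite mxE.
Qed.

Lemma integrable_sum_Rintegral d (T : measurableType d) (P : {measure set T -> \bar R})
    n (F : 'I_n -> T -> R) : (forall i, P.-integrable setT (EFin \o F i)) ->
  P.-integrable setT (EFin \o (fun x => \sum_i F i x)) /\
  \int[P]_x (\sum_i F i x) = \sum_i \int[P]_x F i x.
Proof.
elim: n F => [|n IHn] F iF.
  split.
    apply: (eq_integrable measurableT (cst 0%E)); last exact: integrable0.
    by move=> x _; rewrite /= big_ord0.
  rewrite big_ord0 /Rintegral integral0_eq// => x _.
  by rewrite big_ord0.
have [i1 e1] := IHn (fun i => F (lift ord0 i)) (fun i => iF _).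
split.
  apply: (eq_integrable measurableT
     (fun x => (F ord0 x)%:E + (\sum_i F (lift ord0 i) x)%:E)%E).
    by move=> x _; rewrite /= big_ord_recl EFinD.
  by apply: integrableD => //; exact: iF.
rewrite big_ord_recl -e1 -RintegralD//.
by apply: eq_Rintegral => x _; rewrite big_ord_recl.
Qed.

(** With the second parameter fixed at [a], the likelihood is a factor free of
    the parameter times the likelihood of the reduced model, evaluated at the
    reduced observation [zf y].  That factor cancels in the posterior mean, which
    commutes with the affine map x |-> M x + b. *)
Lemma generalized_Bayes_prod_dirac p m k
    (prior : {measure set 'cV[R]_p -> \bar R}) (V : 'M[R]_p) (D : 'M[R]_k)
    (delta : 'cV[R]_p -> 'cV[R]_p) (a : 'cV[R]_m)
    (theta : 'cV[R]_p * 'cV[R]_m -> 'cV[R]_k) (M : 'M[R]_(k, p)) (b : 'cV[R]_k)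
    (zf : 'cV[R]_k -> 'cV[R]_p) (kappa : 'cV[R]_k -> R) :
  measurable_fun setT theta -> (forall x, theta (x, a) = M *m x + b) ->
  (forall y, 0 < kappa y) ->
  (forall x y, multinormal_pdf (theta (x, a)) D y =
               kappa y * multinormal_pdf x V (zf y)) ->
  generalized_Bayes prior id V delta ->
  generalized_Bayes (prior \x \d_a)%E theta D (fun y => M *m delta (zf y) + b).
Proof.
move=> mt tE k0 pdfE GB y /=.
have [/andP[L0 Loo] ix dE] := GB (zf y).
set l := fun t => multinormal_pdf t V (zf y) in L0 Loo ix dE.
set L := \int[prior]_t l t in dE.
have ml : measurable_fun setT l by exact: measurable_multinormal_pdf2.
have l0 x : 0 <= l x by exact: multinormal_pdf_ge0.
have il : prior.-integrable setT (EFin \o l).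
  apply/integrableP; split; first exact/measurable_EFinP.
  by under eq_integral do rewrite /= ger0_norm//.
have LE : (L%:E = \int[prior]_t (l t)%:E)%E.
  by rewrite fineK//; exact: integrable_fin_num il.
have Lgt0 : 0 < L by rewrite -lte_fin LE.
have mlik : measurable_fun setT (fun t => multinormal_pdf (theta t) D y).
  exact: measurable_multinormal_pdf2.
have Ilik : (\int[prior \x \d_a]_t (multinormal_pdf (theta t) D y)%:E =
    (kappa y)%:E * \int[prior]_t (l t)%:E)%E.
  rewrite integral_prod_dirac; last exact/measurable_EFinP.
  under eq_integral do rewrite pdfE EFinM.
  rewrite ge0_integralZl//.
  - exact/measurable_EFinP.
  - by move=> x _; rewrite lee_fin; exact: l0.
  - by rewrite lee_fin ltW.
pose h j (x : 'cV[R]_p) := x j 0 * l x.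
have ih j : prior.-integrable setT (EFin \o h j) by exact: ix.
pose G i (x : 'cV[R]_p) := \sum_j M i j * h j x.
have [iG GE] : (forall i, prior.-integrable setT (EFin \o G i)) /\
    (forall i, \int[prior]_x G i x = \sum_j M i j * \int[prior]_x h j x).
  suff iS i : prior.-integrable setT (EFin \o G i) /\
      \int[prior]_x G i x = \sum_j M i j * \int[prior]_x h j x.
    by split=> i; case: (iS i).
  have [j|iGi ->] := @integrable_sum_Rintegral _ _ prior p (fun j x => M i j * h j x).
    apply: (eq_integrable measurableT (fun x => (M i j)%:E * (h j x)%:E)%E) => //.
    exact: (integrableZl measurableT (M i j) (ih j)).
  by split=> //; apply: eq_bigr => j _; rewrite RintegralZl.
pose F i (x : 'cV[R]_p) := kappa y * G i x + kappa y * b i 0 * l x.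
have FE i x : theta (x, a) i 0 * multinormal_pdf (theta (x, a)) D y = F i x.
  rewrite pdfE tE !mxE /F /G mulrDl mulr_suml mulr_sumr; congr (_ + _).
    by apply: eq_bigr => j _; rewrite /h /l; ring.
  by rewrite /l; ring.
have mF i : measurable_fun setT (fun t => (theta t i 0 * multinormal_pdf (theta t) D y)%:E).
  apply/measurable_EFinP; apply: measurable_funM => //.
  exact: (measurableT_comp (measurable_coor i) mt).
have ikG i := integrableZl measurableT (kappa y) (iG i).
have ikl i := integrableZl measurableT (kappa y * b i 0) il.
have iF i : prior.-integrable setT (EFin \o F i).
  exact: (integrableD measurableT (ikG i) (ikl i)).
split.
- by rewrite Ilik -LE -EFinM lte_fin ltry andbT mulr_gt0.
- move=> i; apply: integrable_prod_dirac => //.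
  apply: (eq_integrable measurableT (EFin \o F i)) => //.
  by move=> x _; rewrite /= FE.
- move=> i; rewrite /Rintegral Ilik -LE -EFinM /=.
  rewrite integral_prod_dirac//.
  under eq_integral do rewrite FE.
  rewrite -/(Rintegral prior setT (F i)).
  have -> : \int[prior]_x F i x =
      kappa y * (\sum_j M i j * \int[prior]_x h j x) + kappa y * b i 0 * L.
    transitivity (\int[prior]_x (kappa y * G i x) + \int[prior]_x (kappa y * b i 0 * l x)).
      exact: (RintegralD measurableT (ikG i) (ikl i)).
    by congr (_ + _); rewrite RintegralZl// GE.
  have k1 : kappa y != 0 by rewrite gt_eqF.
  have L1 : L != 0 by rewrite gt_eqF.
  rewrite !mxE (eq_bigr (fun j => M i j * \int[prior]_x h j x / L)); last first.
    by move=> j _; rewrite dE mulrA.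
  rewrite -mulr_suml; field.
  by rewrite k1 L1.
Qed.

End generalized_Bayes_theory.

(** * The model in rotated coordinates *)

Section rotated_model.
Context {R : realType} (p m : nat) (A D : 'M[R]_(p + m)) (xi0 : 'cV[R]_m).
Hypotheses (uA : A \in unitmx) (pD : posdefmx D).

(** The covariance matrix of the rotated observation (z1, z2) = A y. *)
Definition zcov : 'M[R]_(p + m) := A *m D *m A^T.
(** The regression coefficient V12 V22^-1 of z1 on z2. *)
Definition zreg : 'M[R]_(p, m) := ursubmx zcov *m invmx (drsubmx zcov).
Definition zcov22 : 'M[R]_m := drsubmx zcov.
Definition zcov112 : 'M[R]_p := ulsubmx zcov - zreg *m dlsubmx zcov.

(** The inverse of y |-> (z4, z2).  The same map sends (xi4, xi2) to mu, because
    the change of coordinates is affine. *)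
Definition of_z (q : 'cV[R]_p * 'cV[R]_m) : 'cV[R]_(p + m) :=
  invmx A *m col_mx (q.1 + zreg *m (q.2 - xi0)) q.2.
Definition z4_of (y : 'cV[R]_(p + m)) : 'cV[R]_p :=
  usubmx (A *m y) - zreg *m (dsubmx (A *m y) - xi0).
Definition benchmarked (delta : 'cV[R]_p -> 'cV[R]_p) (y : 'cV[R]_(p + m)) : 'cV[R]_(p + m) :=
  invmx A *m col_mx (delta (z4_of y)) xi0.

Let T : 'M[R]_(p + m) := block_mx 1%:M (- zreg) 0 1%:M.
Let T' : 'M[R]_(p + m) := block_mx 1%:M zreg 0 1%:M.

Let TT' : T *m T' = 1%:M.
Proof.
rewrite /T /T' mulmx_block !mul1mx !mul0mx !mulmx1 !mulmx0 !add0r addr0 subrr.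
by rewrite -scalar_mx_block.
Qed.

Let pV : posdefmx zcov. Proof. exact: posdefmx_congr_unit. Qed.

Let TVT : T *m zcov *m T^T = block_mx zcov112 0 0 zcov22.
Proof. by have [_] := posdefmx_elim pV erefl. Qed.

Let uT : T \in unitmx. Proof. by case: (mulmx1_unit TT'). Qed.

Let pV112_22 : posdefmx zcov112 /\ posdefmx zcov22.
Proof. by apply: posdefmx_block; rewrite -TVT; exact: posdefmx_congr_unit. Qed.

Lemma zcov112_posdef : posdefmx zcov112. Proof. by case: pV112_22. Qed.
Lemma zcov22_posdef : posdefmx zcov22. Proof. by case: pV112_22. Qed.

Let L := invmx A *m T'.
Let c := invmx A *m col_mx (- (zreg *m xi0)) 0.

Lemma of_z_affine x w : of_z (x, w) = L *m col_mx x w + c.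
Proof.
rewrite /of_z /L /c -mulmxA -mulmxDr; congr (_ *m _).
rewrite /T' mul_block_col !mul1mx mul0mx add0r add_col_mx addr0.
by rewrite mulmxBr addrA.
Qed.

Let uL : L \in unitmx.
Proof. by rewrite unitmx_mul unitmx_inv uA; case: (mulmx1_unit TT'). Qed.

Let LBL : L *m block_mx zcov112 0 0 zcov22 *m L^T = D.
Proof.
have LTA : L *m (T *m A) = 1%:M.
  by rewrite /L -mulmxA (mulmxA T') (mulmx1C TT') mul1mx mulVmx.
transitivity (L *m (T *m A) *m D *m (L *m (T *m A))^T).
  by rewrite -TVT /zcov !trmx_mul !mulmxA.
by rewrite LTA trmx1 mulmx1 mul1mx.
Qed.

Lemma measurable_of_z : measurable_fun setT of_z.
Proof.
have -> : of_z = (fun q => L *m col_mx q.1 q.2 + c).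
  by apply/funext => -[x w]; exact: of_z_affine.
apply: measurable_addmx => //; apply: measurable_mulmx.
exact: measurable_col_mx_pair.
Qed.

Lemma mul_of_z x w : A *m of_z (x, w) = col_mx (x + zreg *m (w - xi0)) w.
Proof. by rewrite mulKVmx. Qed.

Lemma z4_of_z x w : z4_of (of_z (x, w)) = x.
Proof. by rewrite /z4_of mul_of_z col_mxKu col_mxKd addrK. Qed.

Lemma of_zK y : of_z (z4_of y, dsubmx (A *m y)) = y.
Proof. by rewrite /of_z /z4_of /= subrK vsubmxK mulKmx. Qed.

Lemma measurable_z4_of : measurable_fun setT z4_of.
Proof.
have mA : measurable_fun setT (fun y : 'cV[R]_(p + m) => A *m y).
  by apply: measurable_mulmx.
apply: measurable_submx; first exact: measurable_usubmx.
apply: measurable_mulmx; apply: measurable_submx => //.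
exact: measurable_dsubmx.
Qed.

(** Independence of z4 and z2: under the mean of coordinates (x, w), these are
    distributed as the product of N(x, V112) and N(w, V22). *)
Lemma ge0_integral_of_z (x : 'cV[R]_p) (w : 'cV[R]_m) (f : 'cV[R]_(p + m) -> \bar R) :
  measurable_fun setT f -> (forall y, (0 <= f y)%E) ->
  (\int[multinormal (of_z (x, w)) D]_y f y =
   \int[multinormal x zcov112]_u \int[multinormal w zcov22]_v f (of_z (u, v)))%E.
Proof.
move=> mf f0; have [p1 p2] := pV112_22.
have uB : block_mx zcov112 0 0 zcov22 \in unitmx.
  by rewrite unitmxE det_ublock unitrM -!unitmxE !posdefmx_unit.
rewrite of_z_affine -LBL (ge0_integral_multinormal_affine _ _ uL uB mf f0).
have mfL : measurable_fun setT (fun z => f (L *m z + c)).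
  by apply: (measurableT_comp mf); apply: measurable_addmx => //; exact: measurable_mulmx.
apply: (etrans (ge0_integral_multinormal_block x w (posdefmx_unit p1)
  (posdefmx_unit p2) (ltW (posdefmx_det_gt0 p1)) mfL (fun z => f0 _))).
apply: eq_integral => u _; apply: eq_integral => v _.
by rewrite of_z_affine.
Qed.

Lemma multinormal_pdf_of_z (w : 'cV[R]_m) :
  exists2 kappa : 'cV[R]_(p + m) -> R, forall y, 0 < kappa y &
  forall x y, multinormal_pdf (of_z (x, w)) D y =
              kappa y * multinormal_pdf x zcov112 (z4_of y).
Proof.
have [p1 p2] := pV112_22.
have uB : block_mx zcov112 0 0 zcov22 \in unitmx.
  by rewrite unitmxE det_ublock unitrM -!unitmxE !posdefmx_unit.
have L0 : `|\det L| != 0 by rewrite normr_eq0 -unitfE -unitmxE.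
exists (fun y => `|\det L|^-1 * multinormal_pdf w zcov22 (dsubmx (A *m y))).
  move=> y; rewrite mulr_gt0 ?multinormal_pdf_gt0// invr_gt0 lt_neqAle eq_sym L0.
  exact: normr_ge0.
move=> x y.
have := multinormal_pdf_affine c (col_mx x w) (col_mx (z4_of y) (dsubmx (A *m y))) uL uB.
rewrite LBL -!of_z_affine of_zK multinormal_pdf_block ?posdefmx_unit//; last first.
  exact/ltW/posdefmx_det_gt0.
by move=> e; rewrite -mulrA [X in _ = _ * X]mulrC e mulKf.
Qed.

End rotated_model.

(** * Conditioning on z2, admissibility and minimaxity *)

(** The identity |(a + b) / 2|^2 + |a - b|^2 / 4 = |a|^2 / 2 + |b|^2 / 2,
    integrated: strict convexity of the quadratic loss in quantitative form. *)
Lemma risk_midpoint (R : realType) n (A V : 'M[R]_n) (mu : 'cV[R]_n)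
    (d1 d2 : 'cV[R]_n -> 'cV[R]_n) :
  measurable_fun setT d1 -> measurable_fun setT d2 ->
  (risk (A^T *m A) V mu (fun y => 2^-1 *: (d1 y + d2 y)) +
     4^-1%:E * \int[multinormal mu V]_y (sqnorm (A *m (d1 y - d2 y)))%:E =
   2^-1%:E * risk (A^T *m A) V mu d1 + 2^-1%:E * risk (A^T *m A) V mu d2)%E.
Proof.
move=> m1 m2; rewrite !risk_sqnorm.
have s0 (v : 'cV[R]_n) : (0 <= (sqnorm v)%:E)%E by rewrite lee_fin sqnorm_ge0.
have i2 : (0 <= 2^-1%:E :> \bar R)%E by rewrite lee_fin.
have i4 : (0 <= 4^-1%:E :> \bar R)%E by rewrite lee_fin.
have ms (f : 'cV[R]_n -> 'cV[R]_n) : measurable_fun setT f ->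
    measurable_fun setT (fun y => (sqnorm (A *m f y))%:E).
  by move=> mf; apply: measurable_sqnormE; exact: measurable_mulmx.
have mst (f : 'cV[R]_n -> 'cV[R]_n) : measurable_fun setT f ->
    measurable_fun setT (fun y => (sqnorm (A *m (f y - mu)))%:E).
  by move=> mf; apply: ms; exact: measurable_submx.
have mscale r (f : 'cV[R]_n -> \bar R) : measurable_fun setT f ->
    measurable_fun setT (fun y => (r%:E * f y)%E).
  by move=> mf; exact: emeasurable_funM.
have mmid : measurable_fun setT (fun y => 2^-1 *: (d1 y + d2 y)).
  have := measurable_mulmx (2^-1)%:M (measurable_addmx m1 m2).
  by apply: eq_measurable_fun => y _; rewrite mul_scalar_mx.
have md := ms _ (measurable_submx m1 m2).
rewrite -(ge0_integralZl _ measurableT md (fun y _ => s0 _) i4).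
rewrite -(ge0_integralZl _ measurableT (mst _ m1) (fun y _ => s0 _) i2).
rewrite -(ge0_integralZl _ measurableT (mst _ m2) (fun y _ => s0 _) i2).
rewrite -ge0_integralD; [|exact: measurableT|by move=> y _; exact: s0|exact: mst
  |by move=> y _; exact: mule_ge0|exact: mscale].
rewrite -ge0_integralD; [|exact: measurableT|by move=> y _; exact: mule_ge0
  |by apply: mscale; exact: mst|by move=> y _; exact: mule_ge0
  |by apply: mscale; exact: mst].
apply: eq_integral => y _; rewrite -!EFinM -!EFinD; congr (_%:E).
rewrite !mulmxBr -scalemxAr mulmxDr.
move: (A *m d1 y) (A *m d2 y) (A *m mu) => a b t.
rewrite !sqnormE !mulr_sumr -!big_split /=; apply: eq_bigr => i _.
by rewrite !mxE; field.
Qed.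

Lemma half_sum_le (R : realType) (a b : \bar R) :
  (0 <= a -> a < +oo -> b <= a -> 2^-1%:E * b + 2^-1%:E * a <= a)%E.
Proof.
move=> a0 aoo ba; have aE : (a = 2^-1%:E * a + 2^-1%:E * a)%E.
  case: a a0 aoo {ba} => [r| |]//= _ _.
  by rewrite -EFinM -EFinD; congr (_%:E); lra.
by rewrite [leRHS]aE; apply: leeD2r; rewrite lee_pmul2l.
Qed.

Section decision.
Context {R : realType} (p m : nat) (A D : 'M[R]_(p + m)) (xi0 : 'cV[R]_m).
Hypotheses (uA : A \in unitmx) (pD : posdefmx D).

Local Notation V112 := (zcov112 A D).
Local Notation V22 := (zcov22 A D).
Local Notation K := (zreg A D).
Local Notation of_z := (of_z A D xi0).
Local Notation z4_of := (z4_of A D xi0).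
Local Notation benchmarked := (benchmarked A D xi0).
Local Notation Q := (A^T *m A).

Let p112 : posdefmx V112. Proof. exact: zcov112_posdef. Qed.
Let p22 : posdefmx V22. Proof. exact: zcov22_posdef. Qed.

Let s0 n (v : 'cV[R]_n) : (0 <= (sqnorm v)%:E)%E.
Proof. by rewrite lee_fin sqnorm_ge0. Qed.

Let mth : measurable_fun setT of_z. Proof. exact: measurable_of_z. Qed.

Lemma sqnorm_col_mx k n (u : 'cV[R]_k) (v : 'cV[R]_n) :
  sqnorm (col_mx u v) = sqnorm u + sqnorm v.
Proof. by rewrite /sqnorm tr_col_mx mul_row_col mxE. Qed.

Lemma benchmarked_of_z delta x w :
  benchmarked delta (of_z (x, w)) = invmx A *m col_mx (delta x) xi0.
Proof. by rewrite /benchmarked z4_of_z. Qed.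

Lemma measurable_benchmarked delta : measurable_fun setT delta ->
  measurable_fun setT (benchmarked delta).
Proof.
move=> md; apply: measurable_mulmx; apply: measurable_col_mx => //.
by apply: (measurableT_comp md); exact: measurable_z4_of.
Qed.

Lemma Gamma_benchmarked delta : measurable_fun setT delta ->
  (forall xi, \int[multinormal xi V112]_z (sqnorm (delta z))%:E < +oo)%E ->
  Gamma D (benchmarked delta).
Proof.
move=> md doo; split=> [|mu]; first exact: measurable_benchmarked.
rewrite -(of_zK D xi0 uA mu).
have ms : measurable_fun setT (fun y => (sqnorm (benchmarked delta y))%:E).
  by apply: measurable_sqnormE; exact: measurable_benchmarked.
rewrite (ge0_integral_of_z _ uA pD _ _ ms (fun y => s0 _)).
pose M := invmx A *m col_mx 1%:M 0; pose b := invmx A *m col_mx 0 xi0.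
have -> : (\int[multinormal (z4_of mu) V112]_u
     \int[multinormal (dsubmx (A *m mu)) V22]_v (sqnorm (benchmarked delta (of_z (u, v))))%:E =
   \int[multinormal (z4_of mu) V112]_u (sqnorm (M *m delta u + b))%:E)%E.
  apply: eq_integral => u _.
  rewrite -[RHS](multinormal_cst (dsubmx (A *m mu)) _ p22).
  apply: eq_integral => v _; rewrite benchmarked_of_z /M /b -mulmxA -mulmxDr.
  by rewrite mul_col_mx mul1mx mul0mx add_col_mx addr0 add0r.
by apply: sqnorm_integralZD_lty; [exact: multinormal_lty|exact: md|exact: doo].
Qed.

(** On the constrained set the second block of A mu is estimated without error,
    and the first block is xi4. *)
Lemma risk_benchmarked delta xi : measurable_fun setT delta ->
  risk Q D (of_z (xi, xi0)) (benchmarked delta) = risk_star V112 xi delta.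
Proof.
move=> md; rewrite risk_sqnorm.
have ms : measurable_fun setT
    (fun y => (sqnorm (A *m (benchmarked delta y - of_z (xi, xi0))))%:E).
  apply: measurable_sqnormE; apply: measurable_mulmx; apply: measurable_submx => //.
  exact: measurable_benchmarked.
rewrite (ge0_integral_of_z _ uA pD _ _ ms (fun y => s0 _)).
apply: eq_integral => u _; rewrite -[RHS](multinormal_cst xi0 _ p22).
apply: eq_integral => v _; rewrite benchmarked_of_z mulmxBr mulKVmx// mul_of_z//=.
rewrite subrr mulmx0 addr0 opp_col_mx add_col_mx subrr sqnorm_col_mx.
by congr (_%:E); rewrite [X in _ + X](_ : _ = 0) ?addr0//; apply/eqP; rewrite sqnorm_eq0.
Qed.

(** The conditional expectation given z4 of the first rotated block of [delta],
    when the mean satisfies the constraint.  It is an estimator of xi4 because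
    the law N(xi0, V22) of z2 is then known. *)
Definition blackwell (delta : 'cV[R]_(p + m) -> 'cV[R]_(p + m)) (x : 'cV[R]_p) : 'cV[R]_p :=
  meanvec (multinormal xi0 V22) (fun w => usubmx (A *m delta (of_z (x, w)))).

Section blackwell_theory.
Variable delta : 'cV[R]_(p + m) -> 'cV[R]_(p + m).
Hypothesis md : measurable_fun setT delta.

Let g (q : 'cV[R]_p * 'cV[R]_m) : 'cV[R]_p := usubmx (A *m delta (of_z q)).

Let mg : measurable_fun setT g.
Proof.
apply: measurable_usubmx; apply: measurable_mulmx.
exact: (measurableT_comp md).
Qed.

Lemma measurable_blackwell : measurable_fun setT (blackwell delta).
Proof. exact: (measurable_meanvec _ mg). Qed.

Lemma blackwell_le xi t :
  (\int[multinormal xi V112]_x (sqnorm (blackwell delta x - t))%:E <=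
   \int[multinormal (of_z (xi, xi0)) D]_y
     (sqnorm (usubmx (A *m delta y) - t))%:E)%E.
Proof.
have ms : measurable_fun setT (fun y => (sqnorm (usubmx (A *m delta y) - t))%:E).
  apply: measurable_sqnormE; apply: measurable_submx => //.
  by apply: measurable_usubmx; exact: measurable_mulmx.
rewrite (ge0_integral_of_z _ uA pD _ _ ms (fun y => s0 _)).
apply: ge0_le_integral.
- exact: measurableT.
- by move=> x _; exact: s0.
- by apply: measurable_sqnormE; apply: measurable_submx => //; exact: measurable_blackwell.
- apply: (measurable_fun_fubini_tonelli_F
    (fun q => (sqnorm (usubmx (A *m delta (of_z q)) - t))%:E)).
    by apply: (measurableT_comp ms).
  by move=> q; exact: s0.
- move=> x _; apply: sqnorm_meanvec_sub_le; first exact: multinormal_setT.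
  by apply: (measurableT_comp mg); exact: measurable_fun_pair.
Qed.

Lemma risk_blackwell_le xi :
  (risk_star V112 xi (blackwell delta) <= risk Q D (of_z (xi, xi0)) delta)%E.
Proof.
apply: (le_trans (blackwell_le xi xi)); rewrite risk_sqnorm.
apply: ge0_le_integral.
- exact: measurableT.
- by move=> y _; exact: s0.
- apply: measurable_sqnormE; apply: measurable_submx => //.
  by apply: measurable_usubmx; exact: measurable_mulmx.
- by apply: measurable_sqnormE; apply: measurable_mulmx; exact: measurable_submx.
- move=> y _; rewrite lee_fin mulmxBr mul_of_z//= subrr mulmx0 addr0.
  rewrite -[A *m delta y]vsubmxK opp_col_mx add_col_mx sqnorm_col_mx col_mxKu.
  by rewrite lerDl sqnorm_ge0.
Qed.

End blackwell_theory.

Lemma Gamma_blackwell delta : Gamma D delta -> Gamma V112 (blackwell delta).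
Proof.
move=> [md doo]; split=> [|xi]; first exact: measurable_blackwell.
have -> : (\int[multinormal xi V112]_x (sqnorm (blackwell delta x))%:E =
    \int[multinormal xi V112]_x (sqnorm (blackwell delta x - 0))%:E)%E.
  by apply: eq_integral => x _; rewrite subr0.
apply: (le_lt_trans (blackwell_le md xi 0)).
have -> : (\int[multinormal (of_z (xi, xi0)) D]_y (sqnorm (usubmx (A *m delta y) - 0))%:E =
  \int[multinormal (of_z (xi, xi0)) D]_y (sqnorm ((row_mx 1%:M 0 *m A) *m delta y + 0))%:E)%E.
  apply: eq_integral => y _; rewrite subr0 addr0 -mulmxA.
  by rewrite -[in RHS](vsubmxK (A *m delta y)) mul_row_col mul1mx mul0mx addr0.
by apply: sqnorm_integralZD_lty; [exact: multinormal_lty|exact: md|exact: doo].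
Qed.

(** The midpoint of a competitor and of the benchmarked estimator, averaged over
    z2, would improve on [delta] unless both agree almost everywhere. *)
Lemma admissible_benchmarked delta :
  (forall xi, \int[multinormal xi V112]_z (sqnorm (delta z))%:E < +oo)%E ->
  admissible (Gamma V112) (risk_star V112) delta ->
  admissible (Gamma D) (risk Q D) (benchmarked delta).
Proof.
move=> doo [[md _] adm]; have Gmu := Gamma_benchmarked md doo; split=> //.
have mmu := measurable_benchmarked md.
move=> [e [Ge le_e [mu lt_e]]]; have me := Ge.1.
pose mid y := 2^-1 *: (e y + benchmarked delta y).
have Gmid : Gamma D mid.
  have := Gamma_affine (2^-1)%:M 0 pD (GammaD Ge Gmu).
  congr (Gamma D _); apply/funext => y.
  by rewrite mul_scalar_mx addr0.
have mmid := Gmid.1.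
pose gap nu := (\int[multinormal nu D]_y (sqnorm (A *m (e y - benchmarked delta y)))%:E)%E.
have gap0 nu : (0 <= gap nu)%E by apply: integral_ge0 => y _; exact: s0.
have risk0 nu f : (0 <= risk Q D nu f)%E.
  by rewrite risk_sqnorm; apply: integral_ge0 => y _; exact: s0.
have mid_le nu : (risk Q D nu mid + 4^-1%:E * gap nu <= risk Q D nu (benchmarked delta))%E.
  rewrite (risk_midpoint A D nu me mmu).
  exact: half_sum_le (risk0 nu _) (risk_lty A nu pD Gmu) (le_e nu).
have rb_le xi : (risk_star V112 xi (blackwell mid) <=
    risk Q D (of_z (xi, xi0)) mid)%E by exact: risk_blackwell_le.
have gap_eq0 : gap (of_z (0, xi0)) = 0%E.
  apply/eqP; rewrite eq_le gap0 andbT leNgt; apply/negP => gap_gt0.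
  apply: adm; exists (blackwell mid); split.
  - exact: Gamma_blackwell.
  - move=> xi; apply: (le_trans (rb_le xi)); rewrite -(risk_benchmarked _ md).
    apply: le_trans (mid_le _); apply: leeDl; apply: mule_ge0; last exact: gap0.
    by rewrite lee_fin.
  - exists 0; apply: (le_lt_trans (rb_le 0)); rewrite -(risk_benchmarked _ md).
    apply: lt_le_trans (mid_le _); rewrite lteDl; last first.
      by rewrite (ge0_fin_numE (risk0 _ _)); exact: risk_lty.
    by apply: mule_gt0; [rewrite lte_fin|exact: gap_gt0].
have e0 := eq_risk_of_dist0 pD me mmu gap_eq0 mu.
by move: lt_e; rewrite e0 ltxx.
Qed.

(** Both sides are compared with [mean_sqnorm V112], the constant risk of z4. *)
Lemma sup_risk_benchmarked_le delta : measurable_fun setT delta ->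
  (forall xi, \int[multinormal xi V112]_z (sqnorm (delta z))%:E < +oo)%E ->
  (forall xi, risk_star V112 xi delta <= risk_star V112 xi id)%E ->
  forall e, measurable_fun setT e ->
  (sup_risk [set mu : 'cV[R]_(p + m) | dsubmx (A *m mu) = xi0] (risk Q D) (benchmarked delta) <=
   sup_risk [set mu : 'cV[R]_(p + m) | dsubmx (A *m mu) = xi0] (risk Q D) e)%E.
Proof.
move=> md doo dle e me.
apply: (@le_trans _ _ (mean_sqnorm V112)).
  apply: ge_ereal_sup => _ [mu /= mu0 <-].
  rewrite -(of_zK D xi0 uA mu) mu0 (risk_benchmarked _ md); apply: (le_trans (dle _)).
  by rewrite (risk_star_id _ (posdefmx_unit p112)).
apply: (mean_sqnorm_le_sup_risk p112 (measurable_blackwell me)) => xi.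
apply: (le_trans (risk_blackwell_le me xi)).
apply: ereal_sup_ubound; exists (of_z (xi, xi0)); last by [].
by rewrite /= (mul_of_z _ _ uA) col_mxKd.
Qed.

(** The error in the second block is the constant xi0 - xi2, and xi2 is
    arbitrary. *)
Lemma sup_risk_infty e : (0 < m)%N -> measurable_fun setT e ->
  (forall y, dsubmx (A *m e y) = xi0) ->
  sup_risk setT (risk Q D) e = +oo%E.
Proof.
move=> m0 me ey; apply: eq_infty => r.
(* sqnorm t is at least (1 + |r|)^2 >= r, as m > 0. *)
pose t : 'cV[R]_m := const_mx (1 + `|r|).
apply: (@le_trans _ _ (risk Q D (of_z (0, xi0 - t)) e)); last first.
  by apply: ereal_sup_ubound; exists (of_z (0, xi0 - t)); [exact: I|by []].
have t_ge : r <= sqnorm t.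
  rewrite sqnormE (bigD1 (Ordinal m0))//= mxE.
  apply: (@le_trans _ _ ((1 + `|r|) ^+ 2)); last first.
    by rewrite lerDl sumr_ge0// => i _; rewrite sqr_ge0.
  apply: (le_trans (ler_norm r)); rewrite expr2.
  have := normr_ge0 r; nra.
rewrite risk_sqnorm; apply: (@le_trans _ _ (sqnorm t)%:E); first by rewrite lee_fin.
rewrite -[leLHS](multinormal_cst (of_z (0, xi0 - t)) _ pD).
apply: ge0_le_integral.
- exact: measurableT.
- by move=> y _; exact: s0.
- exact: measurable_cst.
- by apply: measurable_sqnormE; apply: measurable_mulmx; exact: measurable_submx.
- move=> y _; rewrite /= lee_fin mulmxBr mul_of_z// -[A *m e y]vsubmxK ey.
  rewrite opp_col_mx add_col_mx sqnorm_col_mx subKr.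
  by rewrite lerDr sqnorm_ge0.
Qed.

End decision.

(** * The benchmarked estimator *)

Section benchmarking.
Context {R : realType} (k m : nat) (Q : 'M[R]_k) (W : 'M[R]_(k, m)) (t0 : 'cV[R]_m).

Lemma constrainedE delta y : W^T *m invmx Q *m W \in unitmx ->
  W^T *m constrained Q W (cst t0) delta y = t0.
Proof.
move=> uG; rewrite /constrained mulmxDr !mulmxA mulmxV// mul1mx.
by rewrite addrC subrK.
Qed.

Lemma constrained_id delta : (forall y, W^T *m delta y = t0) ->
  constrained Q W (cst t0) delta = delta.
Proof.
move=> tE; apply/funext => y.
by rewrite /constrained tE subrr mulmx0 addr0.
Qed.

Lemma Gamma_C_sub (D : 'M[R]_k) : posdefmx D ->
  Gamma_C Q D W (cst t0) `<=` Gamma D.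
Proof.
move=> pD _ [delta Gd <-].
set N := invmx Q *m W *m invmx (W^T *m invmx Q *m W).
rewrite (_ : constrained _ _ _ _ = (fun y => (1%:M - N *m W^T) *m delta y + N *m t0)).
  exact: Gamma_affine.
apply/funext => y; rewrite /constrained -/N mulmxBr mulmxBl mul1mx mulmxA.
by rewrite addrAC addrA.
Qed.

End benchmarking.

Unset Implicit Arguments.
Set Strict Implicit.
Set Printing Implicit Defensive.

Theorem proposition3p4 (R : realType) (p m : nat) (hp : (0 < p)%N)
    (d : 'rV[R]_(p + m)) (hd : forall i, 0 < d 0 i)
    (Q S : 'M[R]_(p + m)) (hQ : posdefmx Q) (hS : S^T = S) (hSQ : S *m S = Q)
    (W : 'M[R]_(p + m, m)) (hW : \rank W = m)
    (H : 'M[R]_(p + m)) (hH : H *m H^T = 1%:M)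
    (hHW : H *m invmx S *m W *m invmx (W^T *m invmx Q *m W) *m W^T
             *m invmx S *m H^T = block_mx 0 0 0 1%:M)
    (t0 : 'cV[R]_m)
    (prior : {measure set 'cV[R]_p -> \bar R})
    (xi4GB : 'cV[R]_p -> 'cV[R]_p) :
  let D := diag_mx d in
  let H1 := usubmx H in
  let H2 := dsubmx H in
  let V11 := H1 *m S *m D *m S *m H1^T in
  let V12 := H1 *m S *m D *m S *m H2^T in
  let V21 := H2 *m S *m D *m S *m H1^T in
  let V22 := H2 *m S *m D *m S *m H2^T in
  let V112 := V11 - V12 *m invmx V22 *m V21 in
  let xi0 := invmx (W^T *m invmx S *m H2^T) *m t0 in
  let z4 (y : 'cV[R]_(p + m)) := H1 *m S *m y - V12 *m invmx V22 *m (H2 *m S *m y - xi0) in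
  let mu_of (xi : 'cV[R]_p * 'cV[R]_m) :=
    invmx S *m (H1^T *m (xi.1 + V12 *m invmx V22 *m (xi.2 - xi0))
                + H2^T *m xi.2) in
  let muGB2 (y : 'cV[R]_(p + m)) := invmx S *m H1^T *m xi4GB (z4 y) + invmx S *m H2^T *m xi0 in
  let GammaC := Gamma_C Q D W (cst t0) in
  W^T *m invmx S *m H2^T \in unitmx ->
  generalized_Bayes prior id V112 xi4GB ->
  (forall xi4, (\int[multinormal xi4 V112]_z (sqnorm (xi4GB z))%:E < +oo)%E) ->
  [/\ generalized_Bayes (prior \x \d_xi0)%E mu_of D muGB2,
      (forall y : 'cV[R]_(p + m), W^T *m muGB2 y = t0) /\ GammaC muGB2,
      (forall mu : 'cV[R]_(p + m),
         W^T *m mu = t0 <-> H2 *m S *m mu = xi0),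
      (admissible (Gamma V112) (risk_star V112) xi4GB ->
         admissible (Gamma D) (risk Q D) muGB2 /\
         admissible GammaC (risk Q D) muGB2)
    & ((forall xi4, (risk_star V112 xi4 xi4GB <= risk_star V112 xi4 id)%E) ->
         minimax setT GammaC (risk Q D) muGB2 /\
         minimax [set mu : 'cV[R]_(p + m) | W^T *m mu = t0]
           (Gamma D) (risk Q D) muGB2)].
Proof.
move=> D H1 H2 V11 V12 V21 V22 V112 xi0 z4 mu_of muGB2 GammaC uB GB doo.
have pD : posdefmx D by exact: posdefmx_diag.
have uS : S \in unitmx.
  by have := posdefmx_unit hQ; rewrite -hSQ unitmx_mul => /andP[].
have uH : H \in unitmx by case: (mulmx1_unit hH).
have HtH : H^T *m H = 1%:M by exact: mulmx1C.
pose A := H *m S.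
have uA : A \in unitmx by rewrite unitmx_mul uH.
have AT : A^T = S *m H^T by rewrite trmx_mul hS.
have QE : Q = A^T *m A.
  by rewrite AT /A mulmxA -(mulmxA S) HtH mulmx1.
have invA : invmx A = invmx S *m H^T.
  apply: (can_inj (mulmxK uA)); rewrite mulVmx// /A mulmxA -(mulmxA (invmx S)).
  by rewrite HtH mulmx1 mulVmx.
have H12 : H = col_mx H1 H2 by rewrite vsubmxK.
have VE : zcov A D = block_mx V11 V12 V21 V22.
  rewrite /zcov AT /A {1 2}H12 tr_col_mx !mulmxA.
  by do 3!rewrite mul_col_mx; rewrite mul_col_row.
have KE : zreg A D = V12 *m invmx V22 by rewrite /zreg VE block_mxKur block_mxKdr.
have V112E : V112 = zcov112 A D.
  by rewrite /zcov112 KE VE block_mxKul block_mxKdl.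
have uAy y : usubmx (A *m y) = H1 *m S *m y by rewrite /A -!mul_usub_mx.
have dAy y : dsubmx (A *m y) = H2 *m S *m y by rewrite /A -!mul_dsub_mx.
have z4E : z4 = z4_of A D xi0.
  by apply/funext => y; rewrite /z4 /z4_of KE uAy dAy.
have invA_col u w : invmx A *m col_mx u w = invmx S *m H1^T *m u + invmx S *m H2^T *m w.
  by rewrite invA {1}H12 tr_col_mx -mulmxA mul_row_col mulmxDr !mulmxA.
have mu_ofE : mu_of = of_z A D xi0.
  apply/funext => q; rewrite /mu_of /of_z KE invA_col mulmxDr !mulmxA.
  by [].
have muE : muGB2 = benchmarked A D xi0 xi4GB.
  by apply/funext => y; rewrite /muGB2 /benchmarked invA_col z4E.
(* hHW reads U (U^T U)^-1 U^T = diag (0, 1); multiplied by U on the right it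
   gives U = (0, U2), so that W^T mu only depends on the second block of A mu. *)
pose U := H *m invmx S *m W.
have SinvT : (invmx S)^T = invmx S by rewrite trmx_inv hS.
have UTU : U^T *m U = W^T *m invmx Q *m W.
  have -> : invmx Q = invmx S *m invmx S.
    have uQ := posdefmx_unit hQ; apply: (can_inj (mulmxK uQ)).
    by rewrite mulVmx// -hSQ mulmxA mulmxKV// mulVmx.
  rewrite /U !trmx_mul SinvT !mulmxA -(mulmxA _ H^T) HtH mulmx1.
  by [].
have BE : (dsubmx U)^T = W^T *m invmx S *m H2^T.
  by rewrite /U -!mul_dsub_mx !trmx_mul SinvT mulmxA.
have uG : W^T *m invmx Q *m W \in unitmx.
  rewrite -UTU; apply: posdefmx_unit.
  rewrite -[X in X *m _]mulmx1 -[X in _ *m X]trmxK.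
  apply: posdefmx_congr.
    move=> v; rewrite trmxK -[U]vsubmxK mul_col_mx -col_mx0 => /eq_col_mx[_ U2v].
    have uU2 : dsubmx U \in unitmx by rewrite -unitmx_tr BE.
    by rewrite -(mulKmx uU2 v) U2v mulmx0.
  have -> : (1%:M : 'M[R]_(p + m)) = diag_mx (const_mx 1) by rewrite diag_const_mx.
  by apply: posdefmx_diag => i; rewrite mxE.
have U1 : usubmx U = 0.
  have UGU : U *m invmx (U^T *m U) *m U^T = block_mx 0 0 0 1%:M.
    by rewrite -hHW UTU /U !trmx_mul SinvT !mulmxA.
  have : U *m invmx (U^T *m U) *m U^T *m U = U.
    by rewrite -mulmxA mulmxKV// UTU.
  rewrite UGU -[X in _ *m X = _]vsubmxK mul_block_col !mul0mx !add0r -[RHS]vsubmxK.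
  by move=> /eq_col_mx[<-].
have WE mu : W^T *m mu = (W^T *m invmx S *m H2^T) *m dsubmx (A *m mu).
  have -> : W^T *m mu = U^T *m (A *m mu).
    rewrite /U /A !trmx_mul SinvT !mulmxA -(mulmxA _ H^T) HtH mulmx1.
    by rewrite mulmxKV.
  rewrite -BE -[in LHS](vsubmxK U) U1 tr_col_mx trmx0 -[X in row_mx _ _ *m X]vsubmxK.
  by rewrite mul_row_col mul0mx add0r.
have WtE mu : W^T *m mu = t0 <-> dsubmx (A *m mu) = xi0.
  rewrite WE; split=> [e|->]; first by rewrite /xi0 -e mulKmx.
  by rewrite /xi0 mulKVmx.
have mxi : measurable_fun setT xi4GB.
  by apply: measurable_generalized_Bayes GB; rewrite V112E; exact: zcov112_posdef.
rewrite V112E in doo GB *.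
have Gmu : Gamma D (benchmarked A D xi0 xi4GB) by exact: Gamma_benchmarked.
have Wmu y : W^T *m muGB2 y = t0.
  by apply/WtE; rewrite muE /benchmarked mulKVmx// col_mxKd.
have GCmu : GammaC muGB2.
  by exists muGB2; [rewrite muE|exact: constrained_id].
have GC_sub e : GammaC e -> Gamma D e by exact: Gamma_C_sub.
have GC_t e y : GammaC e -> dsubmx (A *m e y) = xi0.
  by move=> [delta _ <-]; apply/WtE; exact: constrainedE.
split.
- have [kappa k0 kE] := multinormal_pdf_of_z xi0 uA pD xi0.
  rewrite mu_ofE; have -> : muGB2 = fun y => invmx S *m H1^T *m xi4GB (z4_of A D xi0 y) +
      invmx S *m H2^T *m xi0 by rewrite -z4E.
  apply: (generalized_Bayes_prod_dirac _ _ k0 kE GB).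
    exact: measurable_of_z.
  by move=> x; rewrite /of_z /= subrr mulmx0 addr0 invA_col.
- by split.
- by move=> mu; rewrite -dAy.
- rewrite muE QE => adm.
  have admG := admissible_benchmarked xi0 uA pD doo adm; split=> //.
  split; first by rewrite -muE.
  move=> [e [Ce le lt]]; apply: admG.2.
  by exists e; split=> //; exact: GC_sub.
- move=> dle; have mini := sup_risk_benchmarked_le xi0 uA pD mxi doo dle.
  have setE : [set mu : 'cV[R]_(p + m) | W^T *m mu = t0] =
      [set mu | dsubmx (A *m mu) = xi0].
    by apply/seteqP; split=> mu /= /WtE.
  rewrite muE QE; split; apply: minimax_le.
  + by rewrite -muE.
  + move=> e Ce; have me := (GC_sub _ Ce).1.
    have [m0|m0] := posnP m; last first.
      rewrite [leRHS](sup_risk_infty uA pD m0 me (fun y => GC_t _ y Ce)).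
      exact: leey.
    have -> : [set: 'cV[R]_(p + m)] = [set mu | dsubmx (A *m mu) = xi0].
      apply/seteqP; split=> // mu _ /=; apply/colP => -[i i_m].
      by exfalso; rewrite m0 in i_m.
    exact: mini.
  + exact: Gmu.
  + by move=> e [me _]; rewrite setE; exact: mini.
Qed.
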